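(* Let $n$ be a positive integer, let $X_1,X_2,\dots,X_n$ be pseudocompact Tychonoff spaces and let $\Phi:\prod_{i=1}^n X_i\to\mathbb{R}$ be a separately continuous function. The following conditions are equivalent: (1) the function $\Phi$ extends to a separately continuous function $\widehat{\Phi}:\prod_{i=1}^n\beta X_i\to\mathbb{R}$; (2) the function $\Phi$ is $2$-$\beta$-extendable; (3) the function $\Phi$ is $2$-quasicontinuous.
   Context: A Tychonoff space is pseudocompact if every continuous real-valued function on it is bounded; $\beta X$ is the Stone–Čech compactification of $X$, with $X\subset\beta X$. A map $f: Z\to Y$ between spaces is quasi-continuous if for every $z\in Z$, every neighborhood $O$ of $f(z)$ and every neighborhood $W$ of $z$ there is a non-empty open $U\subset W$ with $f(U)\subset O$. A map on a product $\prod_{\alpha\in A}X_\alpha$ is separately continuous if it is continuous in each variable when all other variables are fixed. Let $\{X_\alpha:\alpha\in A\}$ be a family of spaces, $Y$ a space, $X=\prod_{\alpha\in A}X_\alpha$ and $\Phi: X\to Y$ a map. For $B\subset A$ and $\bar x=(x_\alpha)_{\alpha\in A\setminus B}\in\prod_{\alpha\in A\setminus B}X_\alpha$ define $$r(\Phi,X,\bar x):\prod_{\alpha\in B}X_\alpha\to Y,\quad (x_\alpha)_{\alpha\in B}\mapsto\Phi((x_\alpha)_{\alpha\in A}).$$ For a positive integer $k$: $\Phi$ is $k$-$\beta$-extendable if for each $B\subset A$ with $|B|\le k$ and each $\bar x\in\prod_{\alpha\in A\setminus B}X_\alpha$ the map $g=r(\Phi,X,\bar x)$ extends to a separately continuous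 map $\hat g:\prod_{\alpha\in B}\beta X_\alpha\to\beta Y$. $\Phi$ is $k$-quasicontinuous if for each $B\subset A$ with $|B|\le k$ and each $\bar x\in\prod_{\alpha\in A\setminus B}X_\alpha$ the map $r(\Phi,X,\bar x)$ is quasi-continuous. In the claim these notions are applied with $A=\{1,\dots,n\}$, $Y=\mathbb{R}$, $k=2$. *)

(* Defs.v *)
From HB Require Import structures.
From mathcomp Require Import all_boot all_order all_algebra.
From mathcomp Require Import all_classical all_reals all_analysis.
Import numFieldNormedType.Exports.

Set Implicit Arguments.
Unset Strict Implicit.
Unset Printing Implicit Defensive.

Local Open Scope classical_set_scope.
Local Open Scope ring_scope.

Definition tychonoff_space (T : topologicalType) : Prop :=
  hausdorff_space T /\ completely_regular_space T.

Definition pseudocompact_space (R : realType) (T : topologicalType) : Prop :=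
  forall f : T -> R, continuous f -> [bounded f x | x in [set: T]].

Section StoneCech.
Variables (R : realType) (X : topologicalType).

Definition unit_functions : set (X -> R) :=
  [set f : X -> R | continuous f /\ range f `<=` `[0, 1]].

Definition stone_cech_eval : X -> {ptws unit_functions -> R} :=
  join_product (fun f : unit_functions => (set_val f : X -> R)).

(* The Stone-Cech compactification, as the closure of the canonical image of X
   in the cube indexed by the continuous functions X -> [0, 1]; the factors are
   R rather than [0, 1], which does not change the closure.  For a Tychonoff X,
   the map stone_cech_in below is the embedding through which X is regarded as
   a subspace. *)
Definition stone_cech : Type := closure (range stone_cech_eval).

HB.instance Definition _ :=
  Topological.copy stone_cech (closure (range stone_cech_eval)).

Lemma stone_cech_eval_closure (x : X) :
  stone_cech_eval x \in closure (range stone_cech_eval).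
Proof. by rewrite inE; apply: subset_closure; exists x. Qed.

Definition stone_cech_in (x : X) : stone_cech :=
  exist _ (stone_cech_eval x) (stone_cech_eval_closure x).

End StoneCech.

Definition quasi_continuous (Z Y : topologicalType) (f : Z -> Y) : Prop :=
  forall (z : Z) (O : set Y) (W : set Z), nbhs (f z) O -> nbhs z W ->
    exists U : set Z, [/\ open U, U !=set0, U `<=` W & f @` U `<=` O].

(* [dfwith x i t] is x with its i-th coordinate replaced by t : X i. *)
Definition separately_continuous (I : eqType) (X : I -> topologicalType)
    (Y : topologicalType) (f : (forall i, X i) -> Y) : Prop :=
  forall (x : forall i, X i) (i : I),
    continuous (fun t : X i => f (dfwith x i t)).

Section Restrictions.
Variables (A : finType) (X : A -> topologicalType) (Y : topologicalType).

Definition glue_coords (B : {set A})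
    (xB : forall b : {a : A | a \in B}, X (val b))
    (xC : forall c : {a : A | a \notin B}, X (val c)) : forall a, X a :=
  fun a => match pselect (a \in B) with
           | left aB => xB (exist _ a aB)
           | right aNB => xC (exist _ a (introT negP aNB))
           end.

Definition restrict_coords (Phi : (forall a, X a) -> Y) (B : {set A})
    (xC : forall c : {a : A | a \notin B}, X (val c)) :
    prod_topology (fun b : {a : A | a \in B} => X (val b)) -> Y :=
  fun xB => Phi (glue_coords xB xC).

Definition k_beta_extendable (R : realType) (k : nat)
    (Phi : (forall a, X a) -> Y) : Prop :=
  forall (B : {set A}) (xC : forall c : {a : A | a \notin B}, X (val c)),
    (#|B| <= k)%N ->
    exists ghat : (forall b : {a : A | a \in B}, stone_cech R (X (val b))) ->
                  stone_cech R Y,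
      separately_continuous ghat /\
      forall xB : (forall b : {a : A | a \in B}, X (val b)),
        ghat (fun b => stone_cech_in R (xB b)) =
        stone_cech_in R (restrict_coords Phi xC xB).

Definition k_quasicontinuous (k : nat) (Phi : (forall a, X a) -> Y) : Prop :=
  forall (B : {set A}) (xC : forall c : {a : A | a \notin B}, X (val c)),
    (#|B| <= k)%N -> quasi_continuous (restrict_coords Phi xC).

End Restrictions.

(* Main.v *)
(** Two observations reduce the theorem to pairs of factors.  First, on a pair
    X, Y of pseudocompact spaces a quasi-continuous separately continuous
    function has the Namioka property: every nonempty open set of X contains a
    nonempty open set on which all sections Phi(-, y) oscillate by at most e.
    The proof is Saint-Raymond's argument for compact Y, with points of Y
    replaced by open sets supplied by quasi-continuity, and limits by cluster
    points of sequences of open sets, which exist by pseudocompactness.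
    Conversely, that argument applies to X * beta Y when Phi extends, and the
    Namioka property gives quasi-continuity back.

    Second, the Namioka property in both variables implies Grothendieck's double
    limit condition, which speaks only about sequences of points.  It implies
    that limits along a variable going to a point of beta X_k stay separately
    continuous in the remaining variables, and it survives such a limit, because
    a point of beta X_k can be replaced by a point of X_k as long as only
    countably many continuous functions are involved.  So the factors can be
    compactified one at a time. *)
Require Import Defs.
From mathcomp Require Import all_boot all_order all_algebra.
From mathcomp Require Import all_classical all_reals all_analysis.
From mathcomp Require Import lra.
Import Order.TTheory GRing.Theory Num.Theory.
Import numFieldNormedType.Exports.

Set Implicit Arguments.
Unset Strict Implicit.
Unset Printing Implicit Defensive.

Local Open Scope classical_set_scope.
Local Open Scope ring_scope.

(** * Preliminaries: distance estimates and dependent choice *)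

Ltac dist_lra :=
  repeat match goal with H : context[Num.norm ?t] |- _ => move: H end;
  rewrite ?(ltr_norml, ler_norml, ltr_normr, ler_normr); lra.

Lemma iterate_choice (T : Type) (I : T -> Prop) (E : nat -> T -> T -> Prop)
    (t0 : T) : I t0 ->
  (forall n t, I t -> exists t', I t' /\ E n t t') ->
  exists f : nat -> T, f 0%N = t0 /\ forall n, I (f n) /\ E n (f n) (f n.+1).
Proof.
move=> I0 step.
have [g gP] : exists g : nat -> T -> T,
    forall n t, I t -> I (g n t) /\ E n t (g n t).
  have h (nt : nat * T) : exists t', I nt.2 -> I t' /\ E nt.1 nt.2 t'.
    have [It|nIt] := pselect (I nt.2); last by exists nt.2.
    by have [t' ?] := step nt.1 nt.2 It; exists t'.
  have [g gP] := choice h; exists (fun n t => g (n, t)) => n t It.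
  exact: (gP (n, t)).
pose f := fix f n := if n is m.+1 then g m (f m) else t0.
have If n : I (f n) by elim: n => //= n /(gP n)[].
by exists f; split=> // n; split => //; have [] := gP n _ (If n).
Qed.

(** * Cluster points of sequences of sets *)

Section Clusters.
Variable T : topologicalType.

Definition clusters (V : nat -> set T) (x : T) :=
  forall O, nbhs x O -> forall N, exists n, (N <= n)%N /\ V n `&` O !=set0.

(** The form in which pseudocompactness is used, since a sequence of points may have no cluster
    point in a pseudocompact space. *)
Definition feebly_compact := forall V : nat -> set T,
  (forall n, open (V n)) -> (forall n, V n !=set0) -> exists x, clusters V x.

Lemma clusters_closed (S : topologicalType) (f : T -> S) (C : set S) V x N :
  continuous f -> closed C -> clusters V x ->
  (forall n v, (N <= n)%N -> V n v -> C (f v)) -> C (f x).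
Proof.
move=> cf cC cx VC; apply: contrapT => nC.
have : nbhs x (f @^-1` (~` C)).
  by apply: cf; apply: open_nbhs_nbhs; split => //; exact: closed_openC.
by move=> /cx /(_ N)[n [Nn [v [Vv]]]]; apply; exact: VC Vv.
Qed.

End Clusters.

Section ClustersReal.
Variables (R : realType) (T : topologicalType).
Implicit Types (V : nat -> set T) (f : T -> R).

Lemma closed_dist_le (c d : R) : closed [set x : R | `|x - c| <= d].
Proof.
rewrite (_ : [set _ | _] = `[c - d, c + d]%classic); first exact: itv_closed.
by apply/seteqP; split => x /=; rewrite in_itv /= ler_distl.
Qed.

Lemma closed_dist_ge (c d : R) : closed [set x : R | d <= `|x - c|].
Proof.
rewrite (_ : [set _ | _] = (fun x => `|x - c|) @^-1` [set y | d <= y]).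
  apply: closed_comp => [x _|]; last exact: closed_ge.
  by apply: cvg_norm; apply: cvgB; [exact: cvg_id|exact: cvg_cst].
by [].
Qed.

Lemma clusters_near V b f c d N : continuous f -> clusters V b ->
  (forall n v, (N <= n)%N -> V n v -> `|f v - c| <= d) -> `|f b - c| <= d.
Proof. by move=> cf cb; apply: (clusters_closed cf (@closed_dist_le c d) cb). Qed.

Lemma clusters_far V b f c d N : continuous f -> clusters V b ->
  (forall n v, (N <= n)%N -> V n v -> d <= `|f v - c|) -> d <= `|f b - c|.
Proof. by move=> cf cb; apply: (clusters_closed cf (@closed_dist_ge c d) cb). Qed.

Lemma nbhs_dist f x (e : R) : {for x, continuous f} -> 0 < e ->
  nbhs x [set y | `|f y - f x| < e].
Proof.
move=> cf e0; have /cvgrPdist_lt/(_ e e0) := cf.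
by apply: filterS => y /=; rewrite distrC.
Qed.

Lemma open_dist f (c e : R) : continuous f -> open [set y | `|f y - c| < e].
Proof.
move=> cf; rewrite (_ : [set _ | _] = f @^-1` (ball c e)).
  by apply: open_comp => [x _|]; [exact: cf|exact: ball_open].
by apply/seteqP; split => x /=; rewrite /ball /= distrC.
Qed.

Lemma open_dist_gt f (c e : R) : continuous f -> open [set y | e < `|f y - c|].
Proof.
move=> cf; rewrite (_ : [set _ | _] = ~` (f @^-1` [set z | `|z - c| <= e])).
  by apply: closed_openC; apply: closed_comp => [x _|]; [exact: cf|exact: closed_dist_le].
by apply/seteqP; split => x /=; rewrite ltNge => /negP.
Qed.

Lemma continuous_dist f :
  (forall x e, 0 < e -> nbhs x [set y | `|f y - f x| < e]) -> continuous f.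
Proof.
move=> h x; apply/cvgrPdist_lt => e e0.
by apply: filterS (h x e e0) => y /=; rewrite distrC.
Qed.

End ClustersReal.

(** * Finitely many functions at once *)

Lemma open_all (T : topologicalType) (I : eqType) (s : seq I) (A : I -> set T) :
  (forall i, open (A i)) -> open [set x | forall i, i \in s -> A i x].
Proof.
move=> oA; elim: s => [|i s IH].
  by rewrite (_ : [set _ | _] = setT); [exact: openT|exact/seteqP].
rewrite (_ : [set _ | _] = A i `&` [set x | forall j, j \in s -> A j x]).
  exact: openI.
apply/seteqP; split=> x /= h.
  by split=> [|j js]; apply: h; rewrite inE ?eqxx ?js ?orbT.
by case: h => Ai As j; rewrite inE => /predU1P[->|/As].
Qed.

Lemma nbhs_all_dist (R : realType) (T : topologicalType) (I : eqType)
    (f : I -> T -> R) (s : seq I) (x : T) (e : R) :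
  (forall i, continuous (f i)) -> 0 < e ->
  nbhs x [set y | forall i, i \in s -> `|f i y - f i x| < e].
Proof.
move=> cf e0; apply: open_nbhs_nbhs; split; last by move=> i _ /=; rewrite subrr normr0.
by apply: open_all => i; exact: open_dist.
Qed.

(** The points of [A] are sorted into slabs of width [e] by their value under [f x], for one [x] of
    [F] after the other. [A] varies in the induction because each slab needs a net of points of its
    own. *)
Lemma finite_net (R : realType) (X Y : choiceType) (f : X -> Y -> R) (F : seq X)
    (e : R) (A : set Y) :
  0 < e -> (forall x, exists M : R, forall y, `|f x y| <= M) ->
  exists ys : seq Y, forall y, A y ->
    exists2 y', y' \in ys & A y' /\ forall x, x \in F -> `|f x y - f x y'| < e.
Proof.
move=> e0 fb; elim: F A => [|x F IH] A.
  have [[y0 Ay0]|A0] := pselect (A !=set0).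
    by exists [:: y0] => y _; exists y0; rewrite ?mem_head.
  by exists [::] => y Ay; case: A0; exists y.
have [M fM] := fb x.
(* As [f x + M] lies in [0, 2 M], this number of slabs covers [A]; the claim follows by induction on
   the number of slabs. *)
suff [ys ysP] : exists ys : seq Y, forall y, A y ->
    f x y + M < (Num.truncn ((M + M) / e)).+1%:R * e ->
    exists2 y', y' \in ys &
      A y' /\ forall z, z \in x :: F -> `|f z y - f z y'| < e.
  exists ys => y Ay; apply: ysP => //; rewrite -ltr_pdivrMr //.
  apply: le_lt_trans (truncnS_gt _); rewrite ler_pM2r ?invr_gt0 //.
  by move: (fM y); dist_lra.
elim: (_.+1) => [|N [ys ysP]].
  by exists [::] => y _; rewrite mul0r => h; exfalso; move: (fM y) h; dist_lra.
have [zs zsP] := IH (A `&` [set y | N%:R * e <= f x y + M < N.+1%:R * e]).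
exists (ys ++ zs) => y Ay yN.
have [yN'|yN'] := ltP (f x y + M) (N%:R * e).
  by have [y' y'ys ?] := ysP y Ay yN'; exists y'; rewrite // mem_cat y'ys.
have [|y' y'zs [[Ay' /= /andP[y'1 y'2]] y'F]] := zsP y.
  by split => //=; rewrite yN' yN.
exists y'; first by rewrite mem_cat y'zs orbT.
split => // z; rewrite inE => /predU1P[->|/y'F//].
by move: y'1 y'2 yN yN'; rewrite -natr1 mulrDl mul1r => *; dist_lra.
Qed.

(** * Small oscillation of separately continuous functions *)

(* The Namioka property, in terms of oscillation. *)
Definition locally_small (R : realType) (X Y : topologicalType)
    (Phi : X -> Y -> R) :=
  forall (U : set X) (e : R), open U -> U !=set0 -> 0 < e ->
    exists U' : set X, [/\ open U', U' !=set0, U' `<=` U &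
      forall u u' y, U' u -> U' u' -> `|Phi u y - Phi u' y| <= e].

(* VV is either the family of nonempty open sets of a pseudocompact Y or the
   family of singletons of a compact Y. *)
Section Namioka.
Variables (R : realType) (X Y : topologicalType) (VV : set (set Y)).
Variable Phi : X -> Y -> R.
Hypothesis fcX : feebly_compact X.
Hypothesis VVcl : forall V : nat -> set Y,
  (forall n, VV (V n)) -> exists b, clusters V b.
Hypothesis cPhil : forall x, continuous (Phi x).
Hypothesis cPhir : forall y, continuous (Phi^~ y).
Hypothesis bPhi : forall x, exists M : R, forall y, `|Phi x y| <= M.
Hypothesis qPhi : forall x y U V (e : R), nbhs x U -> nbhs y V -> 0 < e ->
  exists U' V', [/\ open U', U' !=set0, U' `<=` U, VV V' & V' `<=` V] /\
    forall u v, U' u -> V' v -> `|Phi u v - Phi x y| < e.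

(** If no such points existed, moving [y] to a point of a finite net for [F] would change [Phi x y]
    by at most 20 e over all of [W]. On [W'], where the sections at the net points stay within 10 e
    of their value at [x0], the oscillation would be at most 20 + 10 + 10 + 20 = 60 times e, against
    the last hypothesis. *)
Let separate (W : set X) (e : R) (F : seq X) : open W -> W !=set0 -> 0 < e ->
  (forall U', open U' -> U' !=set0 -> U' `<=` W ->
    exists u u' y, [/\ U' u, U' u' & 60 * e < `|Phi u y - Phi u' y|]) ->
  exists x y y', [/\ W x, 20 * e < `|Phi x y - Phi x y'| &
    forall z, z \in F -> `|Phi z y - Phi z y'| < e].
Proof.
move=> oW [x0 Wx0] e0 bad; apply: contrapT => none.
have [ys ysP] := finite_net F setT e0 bPhi.
pose W' := W `&` [set x | forall y, y \in ys -> `|Phi x y - Phi x0 y| < 10 * e].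
have oW' : open W'.
  by apply: openI => //; apply: open_all => y; apply: open_dist; exact: cPhir.
have W'0 : W' !=set0.
  by exists x0; split => // y _ /=; rewrite subrr normr0; lra.
have [u [u' [y [[Wu uys] [Wu' u'ys] ]]]] := bad _ oW' W'0 (@subIsetl _ _ _).
have [y' y'ys [_ yy']] := ysP y I.
have small x : W x -> `|Phi x y - Phi x y'| <= 20 * e.
  by move=> Wx; rewrite leNgt; apply/negP => h; apply: none; exists x, y, y'.
move: (small _ Wu) (small _ Wu') (uys _ y'ys) (u'ys _ y'ys).
by dist_lra.
Qed.

Let step (W : set X) (e : R) (F : seq X) : open W -> W !=set0 -> 0 < e ->
  (forall U', open U' -> U' !=set0 -> U' `<=` W ->
    exists u u' y, [/\ U' u, U' u' & 60 * e < `|Phi u y - Phi u' y|]) ->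
  exists U' V V', [/\ open U', U' !=set0, U' `<=` W, VV V & VV V'] /\
   exists c c', [/\ 20 * e < `|c - c'|,
    forall u v, U' u -> V v -> `|Phi u v - c| < e,
    forall u v, U' u -> V' v -> `|Phi u v - c'| < 2 * e &
    forall z v v', z \in F -> V v -> V' v' -> `|Phi z v - Phi z v'| < 3 * e].
Proof.
move=> oW W0 e0 bad.
have [x [y [y' [Wx xyy' Fyy']]]] := separate F oW W0 e0 bad.
(* Quasi-continuity is used at (x, y), then inside [U1] at (x1, y'). As [U1] lies where Phi(-, y')
   is within e of Phi x y', the second use gives closeness 2 e to that value. *)
have nW : nbhs x (W `&` [set u | `|Phi u y' - Phi x y'| < e]).
  by apply: filterI; [exact: open_nbhs_nbhs|exact: (nbhs_dist (@cPhir y' x) e0)].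
have [U1 [V [[oU1 [x1 U1x1] U1W VVV VF] U1V]]] := qPhi nW (nbhs_all_dist F y cPhil e0) e0.
have nU1 : nbhs x1 U1 by exact: open_nbhs_nbhs.
have [U' [V' [[oU' U'0 U'U1 VVV' V'F] U'V']]] := qPhi nU1 (nbhs_all_dist F y' cPhil e0) e0.
exists U', V, V'; split.
  by split => //; exact: subset_trans (subset_trans U'U1 U1W) (@subIsetl _ _ _).
exists (Phi x y), (Phi x y'); split => //.
- by move=> u v /U'U1; exact: U1V.
- move=> u v U'u V'v; have := U'V' u v U'u V'v; have [_ /=] := U1W _ U1x1.
  by dist_lra.
- move=> z v v' zF Vv V'v'; move: (VF _ Vv z zF) (V'F _ V'v' z zF) (Fyy' z zF).
  by dist_lra.
Qed.

(* Were there no small open subset of Ustar, one could choose x_n in decreasing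
   U_n and V_n, V'_n in VV such that Phi differs by much between V_n and V'_n over
   U_(n+1), but by little over x_0, ..., x_n.  Cluster points b, b' of V_n, V'_n
   are then close over every x_i, hence over a neighbourhood A_i of x_i in U_i,
   and far apart over every cluster point of the U_n; a cluster point of the A_i
   contradicts this. *)
Lemma namioka : locally_small Phi.
Proof.
move=> Ustar e' oUs Us0 e'0; apply: contrapT => nsmall.
pose e := e' / 60; have e0 : 0 < e by rewrite divr_gt0.
have bad U' : open U' -> U' !=set0 -> U' `<=` Ustar ->
    exists u u' y, [/\ U' u, U' u' & 60 * e < `|Phi u y - Phi u' y|].
  move=> oU' U'0 U'U; apply: contrapT => none; apply: nsmall.
  exists U'; split => // u u' y Uu Uu'; rewrite leNgt; apply/negP => h.
  by apply: none; exists u, u', y; rewrite /e mulrC divfK.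
pose state : Type := set X * seq X * (set Y * set Y).
pose Inv (t : state) := [/\ open t.1.1, t.1.1 !=set0 & t.1.1 `<=` Ustar].
pose E (_ : nat) (t t' : state) := [/\ t'.1.1 `<=` t.1.1, VV t'.2.1, VV t'.2.2 &
  exists2 x, t.1.1 x & t'.1.2 = x :: t.1.2 /\
   exists c c', [/\ 20 * e < `|c - c'|,
    forall u v, t'.1.1 u -> t'.2.1 v -> `|Phi u v - c| < e,
    forall u v, t'.1.1 u -> t'.2.2 v -> `|Phi u v - c'| < 2 * e &
    forall z v v', z \in t'.1.2 -> t'.2.1 v -> t'.2.2 v' ->
      `|Phi z v - Phi z v'| < 3 * e]].
have [||f [_ fP]] := @iterate_choice state Inv E (Ustar, [::], (set0, set0)).
- by split.
- move=> n [[W F] VV'] [/= oW W0 WU]; have [x Wx] := W0.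
  have badW U' : open U' -> U' !=set0 -> U' `<=` W -> _ :=
    fun o n s => bad U' o n (subset_trans s WU).
  (* [x] joins the list before [step] is applied, so that the new sets are close over it too. *)
  have [U' [V [V' [[oU' U'0 U'W VVV VVV'] [c [c' cP]]]]]] :=
    step (x :: F) oW W0 e0 badW.
  exists (U', x :: F, (V, V')); split; first by split => //; exact: subset_trans U'W WU.
  by split => //; exists x => //; split => //; exists c, c'.
pose U n := (f n).1.1; pose V n := (f n.+1).2.1; pose V' n := (f n.+1).2.2.
have UI n : Inv (f n) by have [] := fP n.
have UE n : E n (f n) (f n.+1) by have [] := fP n.
have /choice[x xP] : forall n, exists x, U n x /\ (f n.+1).1.2 = x :: (f n).1.2.
  by move=> n; have [_ _ _ [x ? [? _]]] := UE n; exists x.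
have /choice[c cP] : forall n, exists c, [/\ 20 * e < `|c.1 - c.2|,
    forall u v, U n.+1 u -> V n v -> `|Phi u v - c.1| < e,
    forall u v, U n.+1 u -> V' n v -> `|Phi u v - c.2| < 2 * e &
    forall z v v', z \in (f n.+1).1.2 -> V n v -> V' n v' ->
      `|Phi z v - Phi z v'| < 3 * e].
  by move=> n; have [_ _ _ [? _ [_ [c [c' ?]]]]] := UE n; exists (c, c').
have Udec n m : (n <= m)%N -> U m `<=` U n.
  move=> nm; elim: m nm => [|m IH]; first by rewrite leqn0 => /eqP ->.
  rewrite leq_eqVlt => /predU1P[->//|/IH] h; apply: subset_trans h.
  by have [] := UE m.
have xF i n : (i <= n)%N -> x i \in (f n.+1).1.2.
  elim: n => [|n IH]; first by rewrite leqn0 => /eqP ->; rewrite (xP 0%N).2 mem_head.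
  rewrite leq_eqVlt (xP n.+1).2 inE => /predU1P[->|/IH ->]; rewrite ?eqxx ?orbT //.
have VVV n : VV (V n) by have [] := UE n.
have VVV' n : VV (V' n) by have [] := UE n.
have near1 A a n v : clusters A a -> (forall n, A n `<=` U n) -> V n v ->
    `|Phi a v - (c n).1| <= e.
  move=> Aa AU Vv; apply: (@clusters_near R _ _ _ _ _ _ n.+1 (@cPhir v) Aa).
  move=> m u nm /AU/Udec -/(_ _ nm) Uu; have [_ h _ _] := cP n.
  exact: ltW (h u v Uu Vv).
have near2 A a n v : clusters A a -> (forall n, A n `<=` U n) -> V' n v ->
    `|Phi a v - (c n).2| <= 2 * e.
  move=> Aa AU Vv; apply: (@clusters_near R _ _ _ _ _ _ n.+1 (@cPhir v) Aa).
  move=> m u nm /AU/Udec -/(_ _ nm) Uu; have [_ _ h _] := cP n.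
  exact: ltW (h u v Uu Vv).
have [s Us] : exists s, clusters U s by apply: fcX => n; have [] := UI n.
have [b Vb] := VVcl VVV.
(* To link b' with b, only indices [k n] are kept for which V (k n) contains a point that s, x_0,
   ..., x_n cannot tell from b up to e; b' will be a cluster point of the corresponding V'. *)
have /choice[k kP] : forall n, exists k, (n <= k)%N /\ exists2 v, V k v &
    forall z, z \in s :: (f n.+1).1.2 -> `|Phi z v - Phi z b| < e.
  move=> n; have [k [nk [v [Vv vP]]]] := Vb _ (nbhs_all_dist (s :: (f n.+1).1.2) b cPhil e0) n.
  by exists k; split => //; exists v.
have [b' Vb'] := VVcl (fun n => VVV' (k n)).
have xbb' i : `|Phi (x i) b' - Phi (x i) b| <= 4 * e.
  apply: (@clusters_near R _ _ _ _ _ _ i (@cPhil (x i)) Vb') => n v' ni V'v'.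
  have [nk [v Vv vP]] := kP n; have [_ _ _ h] := cP (k n).
  have := vP (x i); rewrite inE xF // orbT => /(_ isT).
  have := h (x i) v v' (xF _ _ (leq_trans ni nk)) Vv V'v'.
  by dist_lra.
(* What remains of the gap 20 after the errors 1 and 2 of [near1] and [near2] and the error 1 of
   [vP]. *)
have sbb' : 16 * e <= `|Phi s b' - Phi s b|.
  apply: (@clusters_far R _ _ _ _ _ _ 0%N (@cPhil s) Vb') => n v' _ V'v'.
  have [nk [v Vv vP]] := kP n; have [h _ _ _] := cP (k n).
  have := vP s (mem_head _ _).
  have := near1 _ _ _ _ Us (fun n => @subset_refl _ (U n)) Vv.
  have := near2 _ _ _ _ Us (fun n => @subset_refl _ (U n)) V'v'.
  by move: h; dist_lra.
(* The bound 4 of [xbb'] is relaxed to a strict 5, which makes [A n] open with [x n] inside. *)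
pose A n := U n `&` [set z | `|(Phi z b' - Phi z b) - 0| < 5 * e].
have [a Aa] : exists a, clusters A a.
  apply: fcX => n.
    apply: openI; first by have [] := UI n.
    by apply: open_dist => z; apply: cvgB; exact: cPhir.
  by exists (x n); split; [exact: (xP n).1|move: (xbb' n) => /=; rewrite subr0; lra].
have abb' : `|(Phi a b' - Phi a b) - 0| <= 5 * e.
  apply: (@clusters_near R _ _ _ (fun z => Phi z b' - Phi z b) _ _ 0%N _ Aa).
    by move=> z; apply: cvgB; exact: cPhir.
  by move=> n v _ [_ /ltW].
have AU n : A n `<=` U n by exact: subIsetl.
have as1 : `|Phi a b - Phi s b - 0| <= 2 * e.
  apply: (@clusters_near R _ _ _ (fun z => Phi a z - Phi s z) _ _ 0%N _ Vb).
    by move=> z; apply: cvgB; exact: cPhil.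
  move=> n v _ Vv; have := near1 _ _ _ _ Us (fun n => @subset_refl _ (U n)) Vv.
  by have := near1 _ _ _ _ Aa AU Vv; dist_lra.
have as2 : `|Phi a b' - Phi s b' - 0| <= 4 * e.
  apply: (@clusters_near R _ _ _ (fun z => Phi a z - Phi s z) _ _ 0%N _ Vb').
    by move=> z; apply: cvgB; exact: cPhil.
  move=> n v _ Vv; have := near2 _ _ _ _ Us (fun n => @subset_refl _ (U n)) Vv.
  by have := near2 _ _ _ _ Aa AU Vv; dist_lra.
(* Going from a to s costs 2 e at b and 4 e at b', so the difference at s is at most 5 + 2 + 4 = 11
   times e, less than 16 e. *)
by move: abb' as1 as2 sbb'; dist_lra.
Qed.

End Namioka.

(** * Pseudocompactness *)

Lemma pseudocompact_bounded (R : realType) (T : topologicalType) (f : T -> R) :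
  pseudocompact_space R T -> continuous f -> exists M : R, forall x, `|f x| <= M.
Proof.
move=> pT cf; have [M [_ Mf]] := pT f cf; exists (M + 1) => x.
by apply: Mf => //; rewrite ltrDl.
Qed.

(** Without a cluster point the V n are locally finite, and a sum of bumps of height n that vanish
    outside V n is continuous and unbounded. *)
Lemma pseudocompact_feebly_compact (R : realType) (T : topologicalType) :
  completely_regular_space T -> pseudocompact_space R T -> feebly_compact T.
Proof.
move=> crT pT V oV V0; apply: contrapT => ncl.
have /choice[ON ONP] : forall x : T, exists ON : set T * nat, nbhs x ON.1 /\
    forall n, (ON.2 <= n)%N -> V n `&` ON.1 = set0.
  move=> x; apply: contrapT => h; apply: ncl; exists x => O xO N.
  apply: contrapT => h'; apply: h; exists (O, N); split => // n Nn.
  apply: contrapT => /eqP/set0P Vn; apply: h'; by exists n.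
pose N x := (ON x).2.
have /choice[x xV] : forall n, exists x, V n x by [].
have /choice[g gP] : forall n, exists g : T -> R, [/\ continuous g,
    forall y, 0 <= g y, g (x n) = n%:R & forall y, ~ V n y -> g y = 0].
  move=> n; have nV : ~ (~` V n) (x n) by move=> /(_ (xV n)).
  have /(@uniform_separatorP _ R)[f [cf f01 fx fV]] :=
    crT _ _ (open_closedC (oV n)) nV.
  exists (fun y => n%:R * (1 - f y)); split.
  - by move=> y; apply: cvgM; [exact: cvg_cst|apply: cvgB; [exact: cvg_cst|exact: cf]].
  - move=> y; apply: mulr_ge0 => //; rewrite subr_ge0.
    by have /f01 : range f (f y) by []; rewrite /= in_itv /= => /andP[].
  - by have -> : f (x n) = 0 by [apply: fx; exists (x n)]; rewrite subr0 mulr1.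
  - by move=> y nVy; have -> : f y = 1 by [apply: fV; exists y]; rewrite subrr mulr0.
have stab y k : (forall n, (k <= n)%N -> g n y = 0) -> forall m, (k <= m)%N ->
    \sum_(n < m) g n y = \sum_(n < k) g n y.
  move=> gk m km; rewrite -(subnKC km) big_split_ord /= [X in _ + X]big1 ?addr0 //.
  by move=> i _; apply: gk; rewrite leq_addr.
have gO y z n : (ON y).1 z -> (N y <= n)%N -> g n z = 0.
  move=> Oz yn; have [_ _ _] := gP n; apply => Vz.
  by have := (ONP y).2 n yn; rewrite -subset0 => /(_ z); apply.
have selfO y : (ON y).1 y by apply: nbhs_singleton; exact: (ONP y).1.
(* The sum is cut off at an index depending on the point; by local finiteness [N y] serves as
   cut-off on the whole neighbourhood [(ON y).1]. *)
pose F y := \sum_(n < N y) g n y.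
have FE y z : (ON y).1 z -> F z = \sum_(n < N y) g n z.
  move=> Oz; rewrite /F -(stab z (N z) _ (maxn (N z) (N y))) ?leq_maxl //.
    by rewrite (stab z (N y)) ?leq_maxr // => n; exact: gO.
  by move=> n; exact: gO.
have cF : continuous F.
  apply: continuous_dist => y e e0.
  have cS : continuous (fun z => \sum_(n < N y) g n z).
    apply: continuous_big => [z|n _]; first exact: add_continuous.
    by have [cg _ _ _] := gP n.
  apply: filterS (filterI (ONP y).1 (nbhs_dist (cS y) e0)) => z [Oz] /=.
  by rewrite (FE y z Oz) (FE y y).
have [M FM] := pseudocompact_bounded pT cF.
have := FM (x (Num.truncn M).+1); set n := (Num.truncn M).+1.
suff : n%:R <= F (x n).
  by have := truncnS_gt M; rewrite -/n => h1 h2 h3; move: (le_trans (ler_norm _) h3); lra.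
(* The n-th bump is counted in F (x n), because V n meets the neighbourhood chosen at x n. *)
have nN : (n < N (x n))%N.
  rewrite ltnNge; apply/negP => h; have := (ONP (x n)).2 n h.
  by rewrite -subset0 => /(_ (x n)); apply.
rewrite /F (bigD1 (Ordinal nN)) //=; have [_ _ -> _] := gP n.
by rewrite lerDl; apply: sumr_ge0 => i _; have [_ g0 _ _] := gP i; exact: g0.
Qed.

(** Approximate solutions of the first n equations up to 1/(n+1) form open sets, and a cluster point
    of these solves all equations. This lets a point of the compactification be traded for a point
    of the space. *)
Lemma feebly_compact_interpolate (R : realType) (X : topologicalType)
    (f : nat -> X -> R) (l : nat -> R) :
  feebly_compact X -> (forall i, continuous (f i)) ->
  (forall N (e : R), 0 < e -> exists x, forall i, (i < N)%N -> `|f i x - l i| < e) ->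
  exists a, forall i, f i a = l i.
Proof.
move=> fcX cf apx.
pose W n := [set x | forall i, i \in iota 0 n -> `|f i x - l i| < n.+1%:R^-1].
have [a Wa] : exists a, clusters W a.
  apply: fcX => n; first by apply: open_all => i; exact: open_dist.
  have [|x xP] := apx n n.+1%:R^-1; first by rewrite invr_gt0.
  by exists x => i; rewrite mem_iota add0n => /xP.
exists a => i; apply/eqP; rewrite -subr_eq0 -normr_le0; apply/ler_addgt0Pr => e e0.
rewrite add0r; pose k := Num.truncn e^-1.
apply: (clusters_near (N := maxn i.+1 k) (cf i) Wa) => n v; rewrite geq_max.
case/andP=> ni kn /(_ i); rewrite mem_iota add0n => /(_ ni) /ltW /le_trans; apply.
rewrite -(invrK e) lef_pV2 ?posrE ?invr_gt0 //; apply/ltW.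
by apply: lt_le_trans (truncnS_gt _) _; rewrite ler_nat ltnS.
Qed.

Lemma compact_clusters (T : topologicalType) (y : nat -> T) :
  compact [set: T] -> exists b, clusters (fun n => [set y n]) b.
Proof.
move=> cT; have [b [_ yb]] := cT (y @ \oo) _ filterT.
exists b => O bO N.
have yN : (y @ \oo) [set y n | n in [set n | (N <= n)%N]].
  by exists N => // n /= Nn; exists n.
have [z [[n /= Nn <-] Oz]] := yb _ _ yN bO.
by exists n; split => //; exists (y n).
Qed.

(** * Pointwise limits and double limits *)

(** [L] belongs to the closure of the functions Phi(-, y) in the topology of pointwise
    convergence. *)
Definition approximable (R : realType) (X : choiceType) (Y : Type)
    (Phi : X -> Y -> R) (L : X -> R) :=
  forall (F : seq X) (e : R), 0 < e ->
    exists y, forall x, x \in F -> `|Phi x y - L x| < e.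

(* Separating near from far, rather than two numbers, makes the condition
   symmetric under a change of sign of Phi. *)
Definition double_limit (R : realType) (X Y : Type) (Phi : X -> Y -> R) :=
  forall (x : nat -> X) (y : nat -> Y) (c d r : R), d < r ->
  (forall m n, (m < n)%N -> `|Phi (x n) (y m) - c| <= d) ->
  (forall m n, (n <= m)%N -> r <= `|Phi (x n) (y m) - c|) -> False.

(** At a discontinuity [x0] of [L], points x_n with L x_n far from L x0 and points y_n are chosen in
    turn: x_n is close to [x0] for the earlier sections Phi(-, y_m), and Phi(-, y_n) is close to [L]
    at [x0] and at all x_i with i <= n. The order of choice gives the near half for m < n and the
    far half for n <= m. *)
Lemma double_limit_continuous (R : realType) (X : topologicalType) (Y : choiceType)
    (Phi : X -> Y -> R) (L : X -> R) :
  (forall y, continuous (Phi^~ y)) -> double_limit Phi -> approximable Phi L ->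
  continuous L.
Proof.
move=> cPhi dl apx; apply: continuous_dist => x0 e' e'0; apply: contrapT => disc.
pose e := e' / 4; have e0 : 0 < e by rewrite divr_gt0.
have [y0 _] := apx [::] e e0.
pose state : Type := seq X * seq Y * (X * Y).
pose E (_ : nat) (t t' : state) :=
  [/\ t'.1.1 = t'.2.1 :: t.1.1, t'.1.2 = t'.2.2 :: t.1.2, 4 * e <= `|L t'.2.1 - L x0|,
   forall y, y \in t.1.2 -> `|Phi t'.2.1 y - Phi x0 y| < e &
   forall x, x \in t'.1.1 -> `|Phi x t'.2.2 - L x| < e].
(* Starting the list with [x0] makes every y_n approximate [L] there; the pair (x0, y0) is a
   placeholder. *)
have [|f [f0 fP]] := @iterate_choice state (fun=> True) E ([:: x0], [::], (x0, y0)) I.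
  move=> n [[F G] xy] _ /=.
  have nG : nbhs x0 [set x | forall y, y \in G -> `|Phi x y - Phi x0 y| < e].
    exact: (nbhs_all_dist (f := fun y x => Phi x y)).
  have [x xG Lx] : exists2 x, forall y, y \in G -> `|Phi x y - Phi x0 y| < e &
      4 * e <= `|L x - L x0|.
    apply: contrapT => none; apply: disc; apply: filterS nG => x xG /=.
    rewrite ltNge; apply/negP => h; apply: none; exists x => //.
    by rewrite /e mulrC divfK.
  have [y yP] := apx (x :: F) e e0.
  by exists (x :: F, y :: G, (x, y)).
have fE n : E n (f n) (f n.+1) by have [] := fP n.
have xF n m : (n <= m)%N -> (f n.+1).2.1 \in (f m.+1).1.1.
  elim: m => [|m IH]; first by rewrite leqn0 => /eqP ->; have [-> _ _ _ _] := fE 0%N; rewrite mem_head.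
  have [-> _ _ _ _] := fE m.+1; rewrite leq_eqVlt => /predU1P[->|/IH h].
    exact: mem_head.
  by rewrite inE h orbT.
have x0F n : x0 \in (f n).1.1.
  elim: n => [|n IH]; first by rewrite f0 mem_head.
  by have [-> _ _ _ _] := fE n; rewrite inE IH orbT.
have yG n m : (n < m)%N -> (f n.+1).2.2 \in (f m).1.2.
  elim: m => // m IH.
  have [_ -> _ _ _] := fE m; rewrite ltnS leq_eqVlt => /predU1P[->|/IH h].
    exact: mem_head.
  by rewrite inE h orbT.
apply: (dl (fun n => (f n.+1).2.1) (fun n => (f n.+1).2.2) (L x0) (2 * e) (3 * e)).
- by lra.
- move=> m n mn; have [_ _ _ h _] := fE n; have := h _ (yG _ _ mn).
  by have [_ _ _ _ h'] := fE m; have := h' _ (x0F m.+1); dist_lra.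
- move=> m n nm; have [_ _ h _ _] := fE n.
  by have [_ _ _ _ h'] := fE m; have := h' _ (xF _ _ nm); dist_lra.
Qed.

Section SmallContinuous.
Variables (R : realType) (X Y : topologicalType) (Phi : X -> Y -> R).
Hypothesis fcX : feebly_compact X.
Hypothesis fcY : feebly_compact Y.
Hypothesis cPhil : forall x, continuous (Phi x).
Hypothesis cPhir : forall y, continuous (Phi^~ y).
Hypothesis smallX : locally_small Phi.
Hypothesis smallY : locally_small (fun y x => Phi x y).
Variable L : X -> R.
Hypothesis apx : approximable Phi L.

(* Otherwise there are u_n in small open U_n with L u_n far from L x0, and v_n in
   small open V_n over which Phi approximates L at x0, u_0, ..., u_n, such that on
   U_n the functions Phi(-, v_i), i < n, are close to their values at x0; cluster
   points a of U_n and b of V_n make Phi a b both near to and far from L x0. *)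
Let near_small (x0 : X) (e : R) : 0 < e -> exists2 O, nbhs x0 O &
  forall U, open U -> U `<=` O ->
   (forall u u' y, U u -> U u' -> `|Phi u y - Phi u' y| <= e) ->
   forall u, U u -> `|L u - L x0| <= 7 * e.
Proof.
move=> e0; apply: contrapT => none.
have [y0 _] := apx [::] e0.
pose state : Type := seq X * seq Y * (set X * X * (set Y * Y)).
pose E (_ : nat) (t t' : state) := let: (U, u, (V, v)) := t'.2 in
  [/\ t'.1.1 = u :: t.1.1, t'.1.2 = v :: t.1.2, open U /\ open V, U u /\ V v &
   [/\ forall x x' y, U x -> U x' -> `|Phi x y - Phi x' y| <= e,
    forall x y y', V y -> V y' -> `|Phi x y - Phi x y'| <= e,
    7 * e < `|L u - L x0|,
    forall x y, U x -> y \in t.1.2 -> `|Phi x y - Phi x0 y| < e &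
    forall x y, x \in t'.1.1 -> V y -> `|Phi x y - L x| < e]].
have [|f [f0 fP]] := @iterate_choice state (fun=> True) E
    ([:: x0], [::], (set0, x0, (set0, y0))) I.
  move=> n [[F G] [[U0 u0] [V0 v0]]] _ /=.
  pose O := [set x | forall y, y \in G -> `|Phi x y - Phi x0 y| < e].
  have nO : nbhs x0 O.
    exact: (nbhs_all_dist (f := fun y x => Phi x y)).
  have [U [u [oU UO sU Uu Lu]]] : exists U u, [/\ open U, U `<=` O,
      forall u u' y, U u -> U u' -> `|Phi u y - Phi u' y| <= e, U u &
      7 * e < `|L u - L x0|].
    apply: contrapT => none'; apply: none; exists O => // U oU UO sU u Uu.
    by rewrite leNgt; apply/negP => h; apply: none'; exists U, u.
  pose W := [set y | forall x, x \in u :: F -> `|Phi x y - L x| < e].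
  have oW : open W by apply: open_all => x; exact: open_dist.
  have W0 : W !=set0 by have [y yP] := apx (u :: F) e0; exists y.
  have [V [oV [v Vv] VW sV]] := smallY oW W0 e0.
  exists (u :: F, v :: G, (U, u, (V, v))); split => //; split => //; split => //.
  - by move=> x y y' Vy Vy'; exact: sV.
  - by move=> x y Ux yG; exact: UO.
  - by move=> x y xF Vy; exact: VW.
pose U n := (f n.+1).2.1.1; pose u n := (f n.+1).2.1.2.
pose V n := (f n.+1).2.2.1; pose v n := (f n.+1).2.2.2.
have fE n : [/\ (f n.+1).1.1 = u n :: (f n).1.1, (f n.+1).1.2 = v n :: (f n).1.2,
    open (U n) /\ open (V n), U n (u n) /\ V n (v n) &
   [/\ forall x x' y, U n x -> U n x' -> `|Phi x y - Phi x' y| <= e,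
    forall x y y', V n y -> V n y' -> `|Phi x y - Phi x y'| <= e,
    7 * e < `|L (u n) - L x0|,
    forall x y, U n x -> y \in (f n).1.2 -> `|Phi x y - Phi x0 y| < e &
    forall x y, x \in (f n.+1).1.1 -> V n y -> `|Phi x y - L x| < e]].
  have [_] := fP n; rewrite /E /U /u /V /v.
  by case: (f n.+1) => [[? ?] [[? ?] [? ?]]].
have uF n m : (n <= m)%N -> u n \in (f m.+1).1.1.
  elim: m => [|m IH]; first by rewrite leqn0 => /eqP ->; have [-> _ _ _ _] := fE 0%N; rewrite mem_head.
  have [-> _ _ _ _] := fE m.+1; rewrite leq_eqVlt => /predU1P[->|/IH h].
    exact: mem_head.
  by rewrite inE h orbT.
have x0F n : x0 \in (f n).1.1.
  elim: n => [|n IH]; first by rewrite f0 mem_head.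
  by have [-> _ _ _ _] := fE n; rewrite inE IH orbT.
have vG n m : (n < m)%N -> v n \in (f m).1.2.
  elim: m => // m IH.
  have [_ -> _ _ _] := fE m; rewrite ltnS leq_eqVlt => /predU1P[->|/IH h].
    exact: mem_head.
  by rewrite inE h orbT.
have [a Ua] : exists a, clusters U a.
  by apply: fcX => n; have [_ _ [? ?] [? ?] _] := fE n => //; exists (u n).
have [b Vb] : exists b, clusters V b.
  by apply: fcY => n; have [_ _ [? ?] [? ?] _] := fE n => //; exists (v n).
(* The limit along U n, n > m, is taken first and that along V m afterwards; for [far] the order is
   reversed. Smallness of V m carries estimates from v m to all of V m, smallness of U n those from
   u n to all of U n. *)
have near : `|Phi a b - L x0| <= 4 * e.
  apply: (clusters_near (N := 0) (@cPhil a) Vb) => m y _ Vy.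
  apply: (clusters_near (N := m.+1) (@cPhir y) Ua) => n x mn Ux.
  have [_ _ _ [_ Vv] [_ sV _ _ VL]] := fE m.
  have [_ _ _ _ [_ _ _ UG _]] := fE n.
  have := UG _ _ Ux (vG _ _ mn); have := VL _ _ (x0F m.+1) Vy.
  by have := sV x _ _ Vy Vv; have := sV x0 _ _ Vy Vv; dist_lra.
have far : 5 * e <= `|Phi a b - L x0|.
  apply: (clusters_far (N := 0) (@cPhir b) Ua) => n x _ Ux.
  have [_ _ _ [Uu _] [sU _ Lu _ _]] := fE n.
  have : `|Phi (u n) b - L (u n)| <= e.
    apply: (clusters_near (N := n) (@cPhil (u n)) Vb) => m y nm Vy; apply: ltW.
    by have [_ _ _ _ [_ _ _ _ h]] := fE m; exact: h (uF _ _ nm) Vy.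
  by have := sU _ _ b Ux Uu; dist_lra.
by move: near far; dist_lra.
Qed.

(** [near_small] controls [L] only on small open sets near a point. For x near x0, a small open set
    near both compares [L x] with [L x0], with error 7 e + 7 e < 15 e. *)
Lemma small_continuous : continuous L.
Proof.
apply: continuous_dist => x0 e' e'0.
pose e := e' / 15; have e0 : 0 < e by rewrite divr_gt0.
have [N nN NP] := near_small x0 e0.
apply: filterS (nbhs_interior nN) => x nxN.
have [N' nN' NP'] := near_small x e0.
have W0 : (N^° `&` N'^°) !=set0 by exists x; split => //; exact: nbhs_singleton (nbhs_interior nN').
have oW : open (N^° `&` N'^°) by apply: openI; exact: open_interior.
have [U [oU [u Uu] UW sU]] := smallX oW W0 e0.
have UO : U `<=` N by apply: subset_trans UW _; move=> z [/interior_subset].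
have UO' : U `<=` N' by apply: subset_trans UW _; move=> z [_ /interior_subset].
have h1 := NP _ oU UO sU _ Uu.
have h2 := NP' _ oU UO' sU _ Uu.
have ee' : 15 * e = e' by rewrite /e mulrC divfK.
by move: h1 h2 => /=; dist_lra.
Qed.

End SmallContinuous.

(** The last hypothesis supplies a pointwise cluster function [L] of the sections at y_m, continuous
    by [small_continuous]. The sets [W k] are then open and contain x_k; at a cluster point [a] all
    Phi a (y m) stay near c while [L a] is far from c, although some Phi a (y m) approximates it. *)
Lemma small_double_limit (R : realType) (X Y : topologicalType) (Phi : X -> Y -> R) :
  feebly_compact X -> feebly_compact Y ->
  (forall x, continuous (Phi x)) -> (forall y, continuous (Phi^~ y)) ->
  locally_small Phi -> locally_small (fun y x => Phi x y) ->
  (forall y : nat -> Y, exists L : X -> R, forall (F : seq X) (e : R) N, 0 < e ->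
    exists2 m, (N <= m)%N & forall x, x \in F -> `|Phi x (y m) - L x| < e) ->
  double_limit Phi.
Proof.
move=> fcX fcY cl cr sX sY lim x y c d r dr near far.
have [L LP] := lim y.
have cL : continuous L.
  apply: (small_continuous fcX fcY cl cr sX sY) => F e e0.
  by have [m _ ?] := LP F e 0%N e0; exists (y m).
(* [d'] and [r'] cut [d, r] into thirds; the gap (r - d) / 3 exceeds the error (r - d) / 4 made in
   approximating [L]. *)
pose d' := (2 * d + r) / 3; pose r' := (d + 2 * r) / 3.
pose W k := [set z | forall m, m \in iota 0 k -> `|Phi z (y m) - c| < d'] `&`
  [set z | r' < `|L z - c|].
have [a Wa] : exists a, clusters W a.
  apply: fcX => k.
    apply: openI; last exact: open_dist_gt.
    by apply: open_all => m; exact: open_dist.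
  exists (x k); split => [m|].
    by rewrite mem_iota add0n => /= mk; apply: le_lt_trans (near _ _ mk) _; rewrite /d'; lra.
  have e0 : 0 < (r - d) / 4 by lra.
  have [m km] := LP [:: x k] _ k e0; move=> /(_ _ (mem_head _ _)).
  by have := far _ _ km; rewrite /= /r'; dist_lra.
have La : r' <= `|L a - c|.
  by apply: (clusters_far (N := 0) cL Wa) => n v _ [_ /ltW].
have Pa m : `|Phi a (y m) - c| <= d'.
  apply: (clusters_near (N := m.+1) (@cr (y m)) Wa) => n v mn [/(_ m) + _].
  by rewrite mem_iota add0n => /(_ mn)/ltW.
have e0 : 0 < (r - d) / 4 by lra.
have [m _] := LP [:: a] _ 0%N e0; move=> /(_ _ (mem_head _ _)).
by have := Pa m; move: La; rewrite /d' /r'; dist_lra.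
Qed.

Lemma continuous_into_product (T : topologicalType) (I : Type)
    (K : I -> topologicalType) (f : T -> prod_topology K) :
  (forall i, continuous (fun x => f x i)) -> continuous f.
Proof.
move=> cf x; apply/cvg_sup => i; move: x.
apply/(@continuousP _ (initial_topology (@^~ i))) => A [B oB <-].
by apply: (open_comp (f := fun x => f x i)) oB => x _; exact: cf.
Qed.

Lemma compact_set_type (T : topologicalType) (A : set T) :
  compact A -> compact [set: set_type A].
Proof.
move=> cA F PF _; have [|p [Ap pF]] := cA (set_val @ F) _.
  by apply: (@filterE _ F) => z; exact: (set_mem (svalP z)).
exists (exist _ p (mem_set Ap)); split => // B N FB [_ [[W oW <-] Wp WN]].
have FvB : (set_val @ F) (set_val @` B) by apply: (@filterS _ F _ B) => // z Bz; exists z.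
have [_ [[z Bz <-] Wz]] := pF _ W FvB (open_nbhs_nbhs (conj oW Wp)).
by exists z; split => //; exact: WN.
Qed.

(** * The Stone-Cech compactification *)

Section StoneCechTheory.
Variables (R : realType) (X : topologicalType).
Local Notation K := (stone_cech R X).
Local Notation e := (@stone_cech_in R X).

Lemma val_stone_cech_continuous :
  continuous (fun q : K => set_val q : {ptws @unit_functions R X -> R}).
Proof. exact: initial_continuous. Qed.

Lemma stone_cech_in_continuous : continuous e.
Proof.
apply: (@continuous_comp_initial _ _ _ set_val e).
apply: continuous_into_product => f.
by have /set_mem[cf _] := svalP f.
Qed.

Lemma stone_cech_dense (q : K) (O : set K) : nbhs q O -> exists x, O (e x).
Proof.
move=> [U [[W oW <-] Wq UO]].
have /set_mem qcl := svalP q.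
have [p [[x _ xp] Wp]] := qcl W (open_nbhs_nbhs (conj oW Wq)).
by exists x; apply: UO; rewrite /= -xp in Wp *.
Qed.

Lemma stone_cech_compact : compact [set: K].
Proof.
apply: compact_set_type.
apply: (@subclosed_compact {ptws @unit_functions R X -> R} _
  [set h | forall i, (`[0, 1]%classic : set R) (h i)]).
- exact: closed_closure.
- apply: (@tychonoff _ (fun=> R : topologicalType) (fun=> `[0, 1]%classic)) => _.
  exact: segment_compact.
- move=> h hcl i.
  pose pr (h : {ptws @unit_functions R X -> R}) : R := h i.
  have cI : closed (pr @^-1` `[0, 1]%classic).
    apply: closed_comp => [x _|]; last exact: itv_closed.
    exact: (@proj_continuous _ (fun=> R : topologicalType) i).
  apply: cI; apply: closure_subset hcl => _ [x _ <-].
  by have /set_mem[_] := svalP i; apply; exists x.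
Qed.

(** The extension of [f] is the projection onto the coordinate indexed by [f]. *)
Lemma stone_cech_unit_extension (f : X -> R) : continuous f ->
  (forall x, 0 <= f x <= 1) ->
  exists2 g : K -> R, continuous g & forall x, g (e x) = f x.
Proof.
move=> cf f01.
have fU : f \in @unit_functions R X.
  by rewrite inE; split => // _ [x _ <-]; rewrite /= in_itv /=.
exists (fun q => (set_val q : {ptws @unit_functions R X -> R}) (exist _ f fU)) => //.
move=> q.
have h2 := @proj_continuous _ (fun=> R) (exist _ f fU : set_type (@unit_functions R X)) (set_val q).
exact: (continuous_comp (@val_stone_cech_continuous q) h2).
Qed.

Lemma stone_cech_extension (f : X -> R) : pseudocompact_space R X -> continuous f ->
  exists2 g : K -> R, continuous g & forall x, g (e x) = f x.
Proof.
move=> pX cf; have [M fM] := pseudocompact_bounded pX cf.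
(* [C] is positive and dominates |f| whatever the sign of [M], so (f + C) / (2 C) takes values in
   [0, 1]. *)
pose C := `|M| + 1; have C0 : 0 < C by rewrite /C; have := normr_ge0 M; lra.
have [||g cg ge] := @stone_cech_unit_extension (fun x => (f x + C) / (2 * C)).
- by move=> x; exact: (cvgM (cvgD (cf x) (cvg_cst _)) (cvg_cst _)).
- move=> x; have := fM x; have := ler_norm M; rewrite ler_norml => h /andP[h1 h2].
  rewrite divr_ge0 /=; [|by rewrite /C; lra|by lra].
  by rewrite ler_pdivrMr ?mul1r; rewrite /C; lra.
exists (fun q => g q * (2 * C) - C).
  by move=> q; exact: (cvgB (cvgM (cg q) (cvg_cst _)) (cvg_cst _)).
by move=> x; rewrite ge divfK ?addrK //; lra.
Qed.

Lemma stone_cech_in_inj : tychonoff_space X -> injective e.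
Proof.
move=> [hX crX] x y exy; apply: contrapT => xy.
have cy : closed [set y].
  by apply: accessible_closed_set1; exact: hausdorff_accessible.
have /(@uniform_separatorP _ R)[f [cf f01 fx fy]] :=
  crX x _ cy xy.
have [|g _ ge] := @stone_cech_unit_extension f cf.
  by move=> z; have /f01 : range f (f z) by []; rewrite /= in_itv.
have : f x = f y by rewrite -!ge exy.
have -> : f x = 0 by apply: fx; exists x.
have -> : f y = 1 by apply: fy; exists y.
by move/eqP; rewrite eq_sym oner_eq0.
Qed.

End StoneCechTheory.

(** * Finite products *)

Section Dfwith.
Variables (I : eqType) (T : I -> Type).
Implicit Types p : forall i, T i.

Lemma dfwith_id p i : dfwith p i (p i) = p.
Proof. by apply: functional_extensionality_dep => j; case: dfwithP. Qed.

Lemma dfwith_dfwith p i a b : dfwith (dfwith p i a) i b = dfwith p i b.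
Proof.
apply: functional_extensionality_dep => j.
have [<-|ij] := eqVneq i j; first by rewrite !dfwithin.
by rewrite !dfwithout.
Qed.

Lemma dfwithC p i j a b : i != j ->
  dfwith (dfwith p i a) j b = dfwith (dfwith p j b) i a.
Proof.
move=> ij; apply: functional_extensionality_dep => k.
have [<-|ik] := eqVneq i k; first by rewrite dfwithin dfwithout ?dfwithin // eq_sym.
have [<-|jk] := eqVneq j k; first by rewrite dfwithin dfwithout // dfwithin.
by rewrite !dfwithout.
Qed.

Lemma dfwith_map (S : I -> Type) (h : forall i, T i -> S i) p i a :
  (fun j => h j (dfwith p i a j)) = dfwith (fun j => h j (p j)) i (h i a).
Proof.
apply: functional_extensionality_dep => k.
have [<-|ik] := eqVneq i k; first by rewrite !dfwithin.
by rewrite !dfwithout.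
Qed.

End Dfwith.

Section Glue.
Variables (A : finType) (T : A -> topologicalType) (B : {set A}).
Implicit Types (xB : forall b : {a : A | a \in B}, T (val b))
  (xC : forall c : {a : A | a \notin B}, T (val c)).

Lemma glue_coords_in xB xC b : glue_coords xB xC (val b) = xB b.
Proof.
rewrite /glue_coords; case: pselect => [bB|/(_ (valP b))//].
by case: b bB => a aB bB /=; rewrite (bool_irrelevance bB aB).
Qed.

Lemma glue_coords_out xB xC c : glue_coords xB xC (val c) = xC c.
Proof.
rewrite /glue_coords; case: pselect => [cB|cB].
  by have := valP c; rewrite cB.
by case: c cB => a aB cB /=; rewrite (bool_irrelevance (introT negP cB) aB).
Qed.

Lemma glue_coords_ext xB xC (x : forall a, T a) : (forall b, x (val b) = xB b) ->
  (forall c, x (val c) = xC c) -> glue_coords xB xC = x.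
Proof.
move=> eB eC; apply: functional_extensionality_dep => a.
have [aB|aC] := boolP (a \in B).
  by rewrite -[a]/(val (exist (fun a => a \in B) a aB)) glue_coords_in eB.
by rewrite -[a]/(val (exist (fun a => a \notin B) a aC)) glue_coords_out eC.
Qed.

Lemma glue_coords_dfwith xB xC b t :
  glue_coords (dfwith xB b t) xC = dfwith (glue_coords xB xC) (val b) t.
Proof.
apply: glue_coords_ext => [b'|c].
  have [<-|bb'] := eqVneq b b'; first by rewrite !dfwithin.
  by rewrite !dfwithout // glue_coords_in.
by rewrite dfwithout ?glue_coords_out //; apply: contraNneq (valP c) => <-; exact: valP.
Qed.

End Glue.


(** * Oscillation and quasi-continuity on two factors *)

(** The conditions on V' are grouped so as to match the hypothesis of [namioka] for the family of
    nonempty open sets. *)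
Definition quasi_continuous2 (R : realType) (X Y : topologicalType)
    (Phi : X -> Y -> R) :=
  forall x y U V (e : R), nbhs x U -> nbhs y V -> 0 < e ->
    exists (U' : set X) (V' : set Y), [/\ open U', U' !=set0, U' `<=` U,
        open V' /\ V' !=set0 & V' `<=` V] /\
      forall u v, U' u -> V' v -> `|Phi u v - Phi x y| < e.

Lemma quasi_continuous2_swap (R : realType) (X Y : topologicalType)
    (Phi : X -> Y -> R) :
  quasi_continuous2 Phi -> quasi_continuous2 (fun y x => Phi x y).
Proof.
move=> qPhi y x V U e nV nU e0.
have [U' [V' [[oU' U'0 U'U [oV' V'0] V'V] UV]]] := qPhi x y U V e nU nV e0.
by exists V', U'; split => // v u Vv Uu; exact: UV.
Qed.

Lemma quasi_continuous2_locally_small (R : realType) (X Y : topologicalType)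
    (Phi : X -> Y -> R) :
  feebly_compact X -> feebly_compact Y -> pseudocompact_space R Y ->
  (forall x, continuous (Phi x)) -> (forall y, continuous (Phi^~ y)) ->
  quasi_continuous2 Phi -> locally_small Phi.
Proof.
move=> fX fY pY cl cr qPhi.
apply: (@namioka _ _ _ [set V | open V /\ V !=set0] _ fX _ cl cr _ qPhi).
  by move=> V VV; apply: fY => n; have [] := VV n.
by move=> x; exact: pseudocompact_bounded pY (cl x).
Qed.

(** For the family of singletons, the quasi-continuity required by [namioka] holds by continuity in
    the first variable, with V' = {y}. *)
Lemma compact_locally_small (R : realType) (X Y : topologicalType)
    (Phi : X -> Y -> R) :
  feebly_compact X -> compact [set: Y] ->
  (forall x, continuous (Phi x)) -> (forall y, continuous (Phi^~ y)) ->
  locally_small Phi.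
Proof.
move=> fX cY cl cr.
apply: (@namioka _ _ _ [set [set y] | y in [set: Y]] _ fX _ cl cr).
- move=> V VV; have /choice[y yV] : forall n, exists y, [set y] = V n.
    by move=> n; have [y _ yV] := VV n; exists y.
  have [b yb] := compact_clusters y cY; exists b.
  by rewrite (_ : V = fun n => [set y n]) //; apply/funext => n; rewrite yV.
- move=> x; apply: pseudocompact_bounded (cl x) => f cf.
  have cfY : {within [set: Y], continuous f} by exact: continuous_subspaceT.
  have [M [Mr MB]] := compact_bounded (continuous_compact cfY cY).
  by exists M; split => // N /MB h y _; apply: h; exists y.
- move=> x y U V e nU nV e0.
  exists (U^° `&` [set u | `|Phi u y - Phi x y| < e]), [set y]; split.
    split.
    + by apply: openI; [exact: open_interior|exact: open_dist].
    + by exists x; split; [exact: nbhs_singleton (nbhs_interior nU)|rewrite /= subrr normr0].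
    + by move=> u [/interior_subset].
    + by exists y.
    + by move=> _ ->; exact: nbhs_singleton.
  by move=> u v [_ ?] ->.
Qed.

(** Continuity at y of a single section Phi u0 controls all sections over a small [U']; the error is
    three times e / 4. *)
Lemma locally_small_quasi_continuous2 (R : realType) (X Y : topologicalType)
    (Phi : X -> Y -> R) :
  (forall x, continuous (Phi x)) -> (forall y, continuous (Phi^~ y)) ->
  locally_small Phi -> quasi_continuous2 Phi.
Proof.
move=> cl cr small x y U V e nU nV e0.
have e4 : 0 < e / 4 by rewrite divr_gt0.
pose W := U^° `&` [set u | `|Phi u y - Phi x y| < e / 4].
have oW : open W by apply: openI; [exact: open_interior|exact: open_dist].
have W0 : W !=set0.
  by exists x; split; [exact: nbhs_singleton (nbhs_interior nU)|rewrite /= subrr normr0].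
have [U' [oU' [u0 Uu0] U'W sU']] := small W (e / 4) oW W0 e4.
exists U', (V^° `&` [set v | `|Phi u0 v - Phi u0 y| < e / 4]); split.
  split => //.
  - by exists u0.
  - by move=> u /U'W[/interior_subset].
  - split; first by apply: openI; [exact: open_interior|exact: open_dist].
    by exists y; split; [exact: nbhs_singleton (nbhs_interior nV)|rewrite /= subrr normr0].
  - by move=> v [/interior_subset].
move=> u v Uu [_ /=]; have [_ /=] := U'W _ Uu0.
by have := sU' _ _ v Uu Uu0; dist_lra.
Qed.

Lemma quasi_continuous2_double_limit (R : realType) (X Y : topologicalType)
    (Phi : X -> Y -> R) :
  tychonoff_space X -> pseudocompact_space R X ->
  tychonoff_space Y -> pseudocompact_space R Y ->
  (forall x, continuous (Phi x)) -> (forall y, continuous (Phi^~ y)) ->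
  quasi_continuous2 Phi -> double_limit Phi.
Proof.
move=> [_ rX] pX [_ rY] pY cl cr qPhi.
have fX := pseudocompact_feebly_compact rX pX.
have fY := pseudocompact_feebly_compact rY pY.
apply: small_double_limit => //.
- exact: quasi_continuous2_locally_small.
- by apply: quasi_continuous2_locally_small => //; exact: quasi_continuous2_swap.
(* A cluster point [q] of the sequence in beta Y gives the pointwise limit: x is sent to the value
   at [q] of the extension of Phi x. *)
move=> y; have [q yq] := compact_clusters (fun n => stone_cech_in R (y n))
  (@stone_cech_compact R Y).
have /choice[g gP] : forall x, exists g : stone_cech R Y -> R,
    continuous g /\ forall y, g (stone_cech_in R y) = Phi x y.
  by move=> x; have [g ? ?] := stone_cech_extension pY (cl x); exists g.
exists (fun x => g x q) => F e N e0.
have nq : nbhs q [set p | forall x, x \in F -> `|g x p - g x q| < e].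
  by apply: nbhs_all_dist => // x; exact: (gP x).1.
have [m [Nm [_ [-> mP]]]] := yq _ nq N; exists m => // x xF.
by rewrite -(gP x).2; exact: mP.
Qed.

Section TwoFactors.
Variables (R : realType) (I : eqType) (K : I -> topologicalType) (i j : I).
Hypothesis ij : i != j.
Hypothesis ijI : forall k, k = i \/ k = j.
Variable f : prod_topology K -> R.

Lemma dfwith2_eq (z w : forall k, K k) : dfwith (dfwith z i (w i)) j (w j) = w.
Proof.
apply: functional_extensionality_dep => k; have [->|->] := ijI k.
  by rewrite dfwithout ?dfwithin // eq_sym.
by rewrite dfwithin.
Qed.

Lemma nbhs_dfwith2 (z w : prod_topology K) (O : set (prod_topology K)) :
  nbhs w O -> exists2 UV, nbhs (w i) UV.1 /\ nbhs (w j) UV.2 &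
    forall u v, UV.1 u -> UV.2 v -> O (dfwith (dfwith z i u) j v).
Proof.
move=> nO.
have cpair : continuous (fun uv : K i * K j =>
    dfwith (dfwith z i uv.1) j uv.2 : prod_topology K).
  apply: continuous_into_product => k; have [->|->] := ijI k.
    rewrite (_ : (fun _ => _) = fst); first by move=> uv; exact: cvg_fst.
    by apply/funext => uv; rewrite dfwithout ?dfwithin // eq_sym.
  rewrite (_ : (fun _ => _) = snd); first by move=> uv; exact: cvg_snd.
  by apply/funext => uv; rewrite dfwithin.
have := cpair (w i, w j) O; rewrite /= dfwith2_eq => /(_ nO)[[U V] /= [nU nV] UVO].
by exists (U, V) => // u v Uu Vv; exact: (UVO (u, v)).
Qed.

Lemma quasi_continuous_factors (z : prod_topology K) : quasi_continuous f ->
  quasi_continuous2 (fun u v => f (dfwith (dfwith z i u) j v)).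
Proof.
move=> qf x y U V e nU nV e0; pose p : prod_topology K := dfwith (dfwith z i x) j y.
rewrite -[dfwith (dfwith z i x) j y]/p.
have pi : p i = x by rewrite /p dfwithout ?dfwithin // eq_sym.
have pj : p j = y by rewrite /p dfwithin.
have nO : nbhs (f p) (ball (f p) e) by exact: nbhsx_ballx.
have nW : nbhs p (proj i @^-1` U `&` proj j @^-1` V).
  by apply: filterI; apply: (@proj_continuous _ K); rewrite /proj ?pi ?pj.
have [Q [oQ [w Qw] QW fQ]] := qf p _ _ nO nW.
have [[U' V'] /= [nU' nV'] UVO] := nbhs_dfwith2 z (open_nbhs_nbhs (conj oQ Qw)).
have [wU wV] := QW _ Qw.
exists U'^°, V'^°; split; last first.
  move=> u v /interior_subset Uu /interior_subset Vv.
  have /fQ : (f @` Q) (f (dfwith (dfwith z i u) j v)).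
    by exists (dfwith (dfwith z i u) j v) => //; exact: UVO.
  by rewrite /ball /= distrC.
have UV u v : U'^° u -> V'^° v -> U u /\ V v.
  move=> /interior_subset Uu /interior_subset Vv.
  have [] := QW _ (UVO _ _ Uu Vv); rewrite /proj /= dfwithin dfwithout ?dfwithin //.
  by rewrite eq_sym.
have U'wi : U'^° (w i) by exact: nbhs_singleton (nbhs_interior nU').
have V'wj : V'^° (w j) by exact: nbhs_singleton (nbhs_interior nV').
split; first exact: open_interior.
- by exists (w i).
- by move=> u /UV /(_ V'wj)[].
- by split; [exact: open_interior|exists (w j)].
- by move=> v V'v; have [] := UV _ _ U'wi V'v.
Qed.

Lemma factors_quasi_continuous :
  (forall z, quasi_continuous2 (fun u v => f (dfwith (dfwith z i u) j v))) ->
  quasi_continuous f.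
Proof.
move=> qf z O W /nbhs_ballP[e /= e0 eO] nW.
have [[U V] /= [nU nV] UVW] := nbhs_dfwith2 z nW.
have [U' [V' [[oU' [u Uu] U'U [oV' [v Vv]] V'V] UVf]]] := qf z _ _ _ _ e nU nV e0.
have UVE w : U' (w i) -> V' (w j) ->
    W w /\ `|f w - f z| < e.
  move=> Uw Vw; rewrite -(dfwith2_eq z w) -{3}(dfwith2_eq z z).
  by split; [apply: UVW; [exact: U'U|exact: V'V]|exact: UVf].
exists (proj i @^-1` U' `&` proj j @^-1` V'); split.
- by apply: openI; apply: open_comp => // x _; exact: proj_continuous.
- exists (dfwith (dfwith z i u) j v); split; rewrite /proj /=.
    by rewrite dfwithout ?dfwithin // eq_sym.
  by rewrite dfwithin.
- by move=> w [Uw Vw]; have [] := UVE w Uw Vw.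
- move=> _ [w [Uw Vw] <-]; apply: eO; rewrite /ball /= distrC.
  by have [] := UVE w Uw Vw.
Qed.

End TwoFactors.

(** * Compactifying one factor at a time *)

Section ExtendCoordinates.
Variables (R : realType) (I : finType) (X : I -> topologicalType).
Variable Phi : (forall i, X i) -> R.
Hypothesis tX : forall i, tychonoff_space (X i).
Hypothesis pX : forall i, pseudocompact_space R (X i).
Hypothesis sPhi : separately_continuous Phi.
Hypothesis dlPhi : forall (x : forall i, X i) i j, i != j ->
  double_limit (fun s t => Phi (dfwith (dfwith x i s) j t)).

Local Notation K := (fun i => stone_cech R (X i)).
Local Notation e := (fun i => @stone_cech_in R (X i)).

(* Functions on the product of the K i are required to be well behaved only at the
   points whose coordinates outside B come from the X i. *)
Definition partial_dom (B : {set I}) i : set (K i) :=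
  [set q | i \in B \/ exists x : X i, e i x = q].

Definition partial_adm (B : {set I}) (p : forall i, K i) :=
  forall i, partial_dom B (p i).

(** The third clause is [double_limit] for every pair of coordinates, taken at admissible points; it
    is the invariant that allows the next coordinate to be added. *)
Definition partial_extension (B : {set I}) (G : (forall i, K i) -> R) : Prop :=
  [/\ forall p i, partial_adm B p -> i \in B ->
        continuous (fun t : K i => G (dfwith p i t)),
      forall p i, partial_adm B p -> i \notin B ->
        continuous (fun t : X i => G (dfwith p i (e i t))),
      forall p i j (s : nat -> K i) (t : nat -> K j) (c d r : R),
        partial_adm B p -> i != j ->
        (forall n, partial_dom B (s n)) -> (forall n, partial_dom B (t n)) -> d < r ->
        (forall m n, (m < n)%N -> `|G (dfwith (dfwith p i (s n)) j (t m)) - c| <= d) ->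
        (forall m n, (n <= m)%N -> r <= `|G (dfwith (dfwith p i (s n)) j (t m)) - c|) ->
        False &
      forall x, G (fun i => e i (x i)) = Phi x].

Lemma partial_extension0 : exists G, partial_extension finset.set0 G.
Proof.
have lift (p : forall i, K i) : partial_adm finset.set0 p ->
    exists x : forall i, X i, p = (fun i => e i (x i)).
  move=> pp; have h i : exists x : X i, e i x = p i.
    by have [|//] := pp i; rewrite finset.in_set0.
  exists (fun i => projT1 (cid (h i))); apply: functional_extensionality_dep => i.
  by rewrite (projT2 (cid (h i))).
have [G GE] : exists G : (forall i, K i) -> R,
    forall x, G (fun i => e i (x i)) = Phi x.
  (* Off the image of the product of the X i the default value is 0; on the image, injectivity of
     the embeddings makes the value well defined. *)
  have /choice[G GP] : forall p : forall i, K i, exists r : R,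
      forall x, p = (fun i => e i (x i)) -> r = Phi x.
    move=> p; have [[x px]|nx] := pselect (exists x : forall i, X i, p = (fun i => e i (x i))).
      exists (Phi x) => y; rewrite px => xy; congr Phi.
      apply: functional_extensionality_dep => i; apply: (stone_cech_in_inj (tX i)).
      exact: (congr1 (fun h : forall i, K i => h i) xy).
    by exists 0 => x px; case: nx; exists x.
  by exists G => x; exact: GP.
exists G; split => //.
- by move=> p i _; rewrite finset.in_set0.
- move=> p i /lift[x ->] _.
  rewrite (_ : (fun _ => _) = fun t => Phi (dfwith x i t)); first exact: sPhi.
  by apply/funext => t; rewrite -GE (dfwith_map (fun i => e i)).
- move=> p i j s t c d r /lift[x ->] ij ss tt dr.
  have /choice[s' ss'] : forall n, exists a, e i a = s n.
    by move=> n; have [|//] := ss n; rewrite finset.in_set0.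
  have /choice[t' tt'] : forall n, exists a, e j a = t n.
    by move=> n; have [|//] := tt n; rewrite finset.in_set0.
  have E n m : G (dfwith (dfwith (fun i => e i (x i)) i (s n)) j (t m)) =
      Phi (dfwith (dfwith x i (s' n)) j (t' m)).
    by rewrite -GE 2!(dfwith_map (fun i => e i)) ss' tt'.
  move=> near far; apply: (@dlPhi x i j ij s' t' c d r dr) => m n mn.
    by rewrite -E; exact: near.
  by rewrite -E; exact: far.
Qed.

(** The section of G over X k is extended to K k and evaluated at p k. Continuity in another
    coordinate follows from [double_limit_continuous], as X k is dense in K k; the third clause
    follows by trading points of K k for points of X k. *)
Lemma partial_extension_step (B : {set I}) k G : k \notin B ->
  partial_extension B G -> exists G', partial_extension (k |: B)%SET G'.
Proof.
move=> kB [Ga Gb Gc Gd].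
have [Ext ExtP] : exists Ext : (X k -> R) -> K k -> R, forall f, continuous f ->
    continuous (Ext f) /\ forall x, Ext f (e k x) = f x.
  have h (f : X k -> R) : exists g : K k -> R, continuous f ->
      continuous g /\ forall x, g (e k x) = f x.
    have [cf|ncf] := pselect (continuous f); last by exists (fun=> 0).
    by have [g cg ge] := stone_cech_extension (@pX k) cf; exists g.
  by have [Ext ExtP] := choice h; exists Ext.
pose sec (p : forall i, K i) (t : X k) := G (dfwith p k (e k t)).
pose G' (p : forall i, K i) := Ext (sec p) (p k).
have adm_e p t : partial_adm (k |: B)%SET p -> partial_adm B (dfwith p k (e k t)).
  move=> pp i; have [<-|ki] := eqVneq k i; first by right; exists t; rewrite dfwithin.
  rewrite dfwithout //; have [|[x]] := pp i; last by right; exists x.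
  by rewrite !inE eq_sym (negbTE ki); left.
have sec_dfwith p a : sec (dfwith p k a) = sec p.
  by apply/funext => t; rewrite /sec dfwith_dfwith.
have inhab (p : forall i, K i) : exists x : X k, True.
  by have [x _] := @stone_cech_dense R (X k) (p k) setT filterT; exists x.
have sec_cont p : partial_adm (k |: B)%SET p -> continuous (sec p).
  move=> pp; have [t0 _] := inhab p; rewrite -(sec_dfwith p (e k t0)).
  by apply: Gb => //; exact: adm_e.
have G'_eq p : partial_adm B p -> G' p = G p.
  move=> pp; have [|[t et]] := pp k; first by rewrite (negbTE kB).
  rewrite /G' -et; have [|_ ->] := ExtP (sec p); last by rewrite /sec et dfwith_id.
  apply: sec_cont => i; have [|] := pp i; last by right.
  by move=> iB; left; rewrite !inE iB orbT.
have domS i q : k != i -> partial_dom (k |: B)%SET q -> @partial_dom B i q.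
  move=> ki [|[x xq]]; last by right; exists x.
  by rewrite !inE eq_sym (negbTE ki); left.
have adm_dfwith C p i (a : K i) : partial_adm C p -> partial_dom C a ->
    partial_adm C (dfwith p i a).
  move=> pp aa j; have [<-|ij] := eqVneq i j; first by rewrite dfwithin.
  by rewrite dfwithout.
(* For countably many points with the same k-th coordinate q, one t in X k yields the values of G'
   at all of them. *)
have interp (p : nat -> forall i, K i) q : (forall m, partial_adm (k |: B)%SET (p m)) ->
    (forall m, p m k = q) -> exists t, forall m, G' (p m) = G (dfwith (p m) k (e k t)).
  move=> pp pq.
  have fX := pseudocompact_feebly_compact (tX k).2 (@pX k).
  have cE m := ExtP _ (sec_cont _ (pp m)).
  have [N eps eps0|t tP] := @feebly_compact_interpolate R (X k) (fun m => sec (p m))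
      (fun m => G' (p m)) fX (fun m => sec_cont _ (pp m)).
    have nq : nbhs q [set u | forall m, m \in iota 0 N ->
        `|Ext (sec (p m)) u - Ext (sec (p m)) q| < eps].
      by apply: nbhs_all_dist => // m; exact: (cE m).1.
    have [x xP] := stone_cech_dense nq; exists x => m mN.
    by have := xP m; rewrite mem_iota /= add0n (cE m).2 /G' pq; exact.
  by exists t => m; rewrite -tP.
(* [h] is either the identity of K i or the embedding of X i, so that both continuity clauses are
   served. *)
have cont_dfwith i (T : topologicalType) (h : T -> K i) p : k != i ->
    (forall t, partial_dom B (h t)) ->
    (forall p, partial_adm B p -> continuous (fun t => G (dfwith p i (h t)))) ->
    partial_adm (k |: B)%SET p -> continuous (fun t => G' (dfwith p i (h t))).
  move=> ki hB hc pp; have [t0 _] := inhab p.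
  have domS' t : partial_dom (k |: B)%SET (h t).
    by have [iB|] := hB t; [left; rewrite !inE iB orbT|right].
  apply: (@double_limit_continuous R T (X k) (fun t s => sec (dfwith p i (h t)) s)).
  - move=> s; rewrite (_ : (fun _ => _) = fun t => G (dfwith (dfwith p k (e k s)) i (h t))).
      by apply: hc; exact: adm_e.
    by apply/funext => t; rewrite /sec dfwithC // eq_sym.
  - move=> x y c d r dr near far.
    have E n m : G (dfwith (dfwith (dfwith p k (e k t0)) i (h (x n))) k (e k (y m))) =
        sec (dfwith p i (h (x n))) (y m).
      by rewrite -(dfwithC _ _ _ (i := i)) 1?eq_sym // dfwith_dfwith.
    have ik : i != k by rewrite eq_sym.
    apply: (Gc _ i k (h \o x) (fun n => e k (y n)) c d r (adm_e _ t0 pp) ik _ _ dr).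
    + by move=> n; exact: hB.
    + by move=> n; right; exists (y n).
    + by move=> m n mn; rewrite E; exact: near.
    + by move=> m n mn; rewrite E; exact: far.
  - move=> F eps eps0.
    have cE t := ExtP _ (sec_cont _ (adm_dfwith _ _ i (h t) pp (domS' t))).
    have nq : nbhs (p k) [set u | forall t, t \in F ->
        `|Ext (sec (dfwith p i (h t))) u - Ext (sec (dfwith p i (h t))) (p k)| < eps].
      by apply: nbhs_all_dist => // m; exact: (cE m).1.
    have [x xP] := stone_cech_dense nq; exists x => t tF.
    have := xP t tF; rewrite /= (cE t).2 /G' dfwithout //.
    by rewrite eq_sym.
exists G'; split.
- move=> p i pp; have [-> _|ik iB] := eqVneq i k.
    rewrite (_ : (fun _ => _) = Ext (sec p)); first by have [] := ExtP _ (sec_cont _ pp).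
    by apply/funext => t; rewrite /G' sec_dfwith dfwithin.
  have {}iB : i \in B by move: iB; rewrite !inE (negbTE ik).
  apply: (@cont_dfwith i (K i) id) => //; first by rewrite eq_sym.
    by left.
  by move=> q qq; exact: Ga.
- move=> p i pp; rewrite !inE negb_or => /andP[ik iB].
  apply: (@cont_dfwith i (X i) (e i)) => //; first by rewrite eq_sym.
    by move=> t; right; exists t.
  by move=> q qq; exact: Gb.
- move=> p i j s t c d r pp ij ss tt dr near far.
  have PP n m : partial_adm (k |: B)%SET (dfwith (dfwith p i (s n)) j (t m)).
    by apply: (adm_dfwith) => //; exact: adm_dfwith.
  (* If i = k, each s n is replaced by a point of X k that gives the right values for all t m at
     once; j = k is symmetric, and otherwise a single point replaces p k for all pairs (n, m). *)
  have [ki|ki] := eqVneq k i.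
    subst i.
    have /choice[s' s'P] : forall n, exists a : X k, forall m,
        G' (dfwith (dfwith p k (s n)) j (t m)) =
        G (dfwith (dfwith p k (e k a)) j (t m)).
      move=> n; have [m|a aP] := interp (fun m => dfwith (dfwith p k (s n)) j (t m))
          (s n) (PP n).
        by rewrite dfwithout ?dfwithin // eq_sym.
      by exists a => m; rewrite aP dfwithC 1?eq_sym // dfwith_dfwith.
    apply: (Gc (dfwith p k (e k (s' 0%N))) k j (fun n => e k (s' n)) t c d r _ ij _ _ dr).
    + exact: adm_e.
    + by move=> n; right; exists (s' n).
    + by move=> n; exact: domS.
    + by move=> m n mn; rewrite dfwith_dfwith -s'P; exact: near.
    + by move=> m n mn; rewrite dfwith_dfwith -s'P; exact: far.
  have [kj|kj] := eqVneq k j.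
    subst j.
    have /choice[t' t'P] : forall m, exists a : X k, forall n,
        G' (dfwith (dfwith p i (s n)) k (t m)) =
        G (dfwith (dfwith p i (s n)) k (e k a)).
      move=> m; have [n|a aP] := interp (fun n => dfwith (dfwith p i (s n)) k (t m))
          (t m) (fun n => PP n m).
        by rewrite dfwithin.
      by exists a => n; rewrite aP dfwith_dfwith.
    have E n m : dfwith (dfwith (dfwith p k (e k (t' 0%N))) i (s n)) k (e k (t' m)) =
        dfwith (dfwith p i (s n)) k (e k (t' m)).
      by rewrite -(dfwithC _ _ _ (i := i)) // dfwith_dfwith.
    apply: (Gc (dfwith p k (e k (t' 0%N))) i k s (fun n => e k (t' n)) c d r _ ij _ _ dr).
    + exact: adm_e.
    + by move=> n; exact: domS.
    + by move=> n; right; exists (t' n).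
    + by move=> m n mn; rewrite E -t'P; exact: near.
    + by move=> m n mn; rewrite E -t'P; exact: far.
  (* The pairs (n, m) are enumerated to form one sequence; codes of no pair fall back to (0, 0). *)
  pose P (l : nat) : forall i, K i :=
    let nm := odflt (0%N, 0%N) (unpickle l) in dfwith (dfwith p i (s nm.1)) j (t nm.2).
  have ik : i != k by rewrite eq_sym.
  have jk : j != k by rewrite eq_sym.
  have [l|l|a aP] := interp P (p k).
  + exact: PP.
  + by rewrite /P !dfwithout // eq_sym.
  have E n m : G' (dfwith (dfwith p i (s n)) j (t m)) =
      G (dfwith (dfwith (dfwith p k (e k a)) i (s n)) j (t m)).
    have := aP (pickle (n, m)); rewrite /P pickleK /= => ->; congr G.
    by rewrite (dfwithC _ _ _ jk) (dfwithC _ _ _ ik).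
  apply: (Gc (dfwith p k (e k a)) i j s t c d r _ ij _ _ dr).
  + exact: adm_e.
  + by move=> n; exact: domS.
  + by move=> n; exact: domS.
  + by move=> m n mn; rewrite -E; exact: near.
  + by move=> m n mn; rewrite -E; exact: far.
- by move=> x; rewrite G'_eq ?Gd // => i; right; exists (x i).
Qed.

Lemma separately_continuous_extension : exists Phihat : (forall i, K i) -> R,
  separately_continuous Phihat /\
  forall x, Phihat (fun i => e i (x i)) = Phi x.
Proof.
have [B [G [BT [Ga _ _ Gd]]]] : exists (B : {set I}) G, {subset enum I <= B} /\
    partial_extension B G.
  elim: (enum I) => [|k s [B [G [sB GP]]]].
    by have [G GP] := partial_extension0; exists finset.set0, G.
  have [kB|kB] := boolP (k \in B).
    by exists B, G; split => // i; rewrite inE => /predU1P[->//|/sB].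
  have [G' G'P] := partial_extension_step kB GP; exists (k |: B)%SET, G'.
  by split => // i; rewrite !inE => /predU1P[->|/sB ->]; rewrite ?eqxx ?orbT.
exists G; split => // p i; apply: Ga; last by apply: BT; rewrite mem_enum.
by move=> j; left; apply: BT; rewrite mem_enum.
Qed.

End ExtendCoordinates.

(** * Implications between the three conditions *)

Lemma continuous_quasi_continuous (Z Y : topologicalType) (f : Z -> Y) :
  continuous f -> quasi_continuous f.
Proof.
move=> cf z O W nO nW; exists (W^° `&` f @^-1` O^°); split.
- apply: openI; first exact: open_interior.
  by apply: open_comp; [move=> x _; exact: cf|exact: open_interior].
- exists z; split; first exact: nbhs_singleton (nbhs_interior nW).
  exact: nbhs_singleton (nbhs_interior nO).
- by move=> w [/interior_subset].
- by move=> _ [w [_ /interior_subset Ow] <-].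
Qed.

Lemma continuous_truncated_dist (R : realType) (T : topologicalType) (f : T -> R)
    (c : R) : continuous f -> continuous (fun t => Num.min 1 `|f t - c|).
Proof.
move=> cf t; apply: (@continuous_min _ _ (fun=> 1) (fun t => `|f t - c|)).
  exact: cvg_cst.
by apply: cvg_norm; apply: cvgB; [exact: cf|exact: cvg_cst].
Qed.

(** In the second condition the extensions take values in beta R, possibly outside R. The truncated
    distance to [c] is bounded, hence extends to beta R, and for c = Phi x y it detects closeness to
    Phi x y. *)
Lemma truncated_dist_quasi_continuous2 (R : realType) (X Y : topologicalType)
    (Phi : X -> Y -> R) :
  (forall x, continuous (Phi x)) -> (forall y, continuous (Phi^~ y)) ->
  (forall c, locally_small (fun u v => Num.min 1 `|Phi u v - c|)) ->
  quasi_continuous2 Phi.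
Proof.
move=> cl cr small x y U V e nU nV e0.
(* Below 1 the truncated distance is the distance itself. *)
have e1 : 0 < Num.min 1 e by rewrite lt_min ltr01.
have [u|v|U' [V' [UV' UVP]]] :=
    locally_small_quasi_continuous2 _ _ (small (Phi x y)) nU nV e1.
- exact: continuous_truncated_dist.
- exact: (continuous_truncated_dist (f := Phi^~ v)).
exists U', V'; split => // u v Uu Vv; have := UVP u v Uu Vv.
rewrite subrr normr0 (min_r ler01) subr0 ger0_norm ?le_min ?ler01 ?normr_ge0 //.
by rewrite lt_min !gt_min ltxx /= => /andP[d1 /orP[e1'|//]]; apply: lt_trans d1 e1'.
Qed.

Section Restrictions.
Variables (R : realType) (A : finType) (X : A -> topologicalType).
Variable Phi : (forall a, X a) -> R.
Hypothesis sPhi : separately_continuous Phi.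

Lemma restrict_coords_dfwith (B : {set A})
    (xB : forall b : {a : A | a \in B}, X (val b))
    (xC : forall c : {a : A | a \notin B}, X (val c)) b t :
  restrict_coords Phi xC (dfwith xB b t) =
    Phi (dfwith (glue_coords xB xC) (val b) t).
Proof. by rewrite /restrict_coords glue_coords_dfwith. Qed.

Lemma continuous_dfwith2l (x : forall a, X a) i j t : i != j ->
  continuous (fun s => Phi (dfwith (dfwith x i s) j t)).
Proof.
move=> ij; rewrite (_ : (fun _ => _) = fun s => Phi (dfwith (dfwith x j t) i s)).
  exact: sPhi.
by apply/funext => s; rewrite dfwithC.
Qed.

Lemma k_quasicontinuous_double_limit :
  (forall i, tychonoff_space (X i) /\ pseudocompact_space R (X i)) ->
  k_quasicontinuous 2 Phi ->
  forall (x : forall a, X a) i j, i != j ->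
    double_limit (fun s t => Phi (dfwith (dfwith x i s) j t)).
Proof.
move=> tpX qPhi x i j ij.
have [[tXi pXi] [tXj pXj]] := (tpX i, tpX j).
apply: quasi_continuous2_double_limit => //.
- by move=> t; exact: continuous_dfwith2l.
pose B := [set i; j]%SET.
have iB : i \in B by rewrite !inE eqxx.
have jB : j \in B by rewrite !inE eqxx orbT.
pose bi : {a | a \in B} := exist _ i iB; pose bj : {a | a \in B} := exist _ j jB.
have bij : bi != bj by [].
have onlyij k : k = bi \/ k = bj.
  have : (val k == i) || (val k == j) by have := valP k; rewrite !inE.
  by move=> /orP[] /eqP kE; [left|right]; exact: val_inj.
have B2 : (#|B| <= 2)%N by rewrite cards2 ij.
have q := quasi_continuous_factors bij onlyij (fun b => x (val b))
  (qPhi B (fun c => x (val c)) B2).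
move=> s t U V e nU nV e0; have [U' [V' [P UVP]]] := q s t U V e nU nV e0.
have gx : glue_coords (fun b : {a | a \in B} => x (val b)) (fun c => x (val c)) = x.
  exact: glue_coords_ext.
exists U', V'; split => // u v Uu Vv; have := UVP u v Uu Vv.
by rewrite !restrict_coords_dfwith !glue_coords_dfwith gx.
Qed.

Lemma k_beta_extendable_quasicontinuous :
  (forall i, tychonoff_space (X i) /\ pseudocompact_space R (X i)) ->
  k_beta_extendable R 2 Phi -> k_quasicontinuous 2 Phi.
Proof.
move=> tpX bPhi B xC B2.
(* With at most one coordinate in [B] the restriction is constant or depends on one variable, hence
   is continuous. *)
have [[b0 [b1 b01]]|same] := pselect (exists b0 b1 : {a | a \in B}, b0 != b1); last first.
  apply: continuous_quasi_continuous => z.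
  have [[b0 _]|none] := pselect (exists b : {a | a \in B}, True); last first.
    rewrite (_ : restrict_coords Phi xC = fun=> restrict_coords Phi xC z).
      exact: cst_continuous.
    apply/funext => w; congr (restrict_coords _ _ _).
    by apply: functional_extensionality_dep => b; case: none; exists b.
  rewrite (_ : restrict_coords Phi xC =
      (fun t => Phi (dfwith (glue_coords z xC) (val b0) t)) \o proj b0).
    apply: continuous_comp; last exact: sPhi.
    exact: (@proj_continuous _ (fun b : {a | a \in B} => X (val b))).
  apply/funext => w /=; rewrite -restrict_coords_dfwith; congr (restrict_coords _ _ _).
  apply: functional_extensionality_dep => b; have -> : b = b0.
    by apply: contrapT => /eqP bb0; apply: same; exists b, b0.
  by rewrite dfwithin.
have only01 k : k = b0 \/ k = b1.
  apply: contrapT => /not_orP[/eqP kb0 /eqP kb1].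
  have : (#|[set val k; val b0; val b1]%SET| <= #|B|)%N.
    apply: subset_leq_card; apply/fintype.subsetP => a.
    by rewrite !inE => /orP[/orP[]|] /eqP ->; exact: valP.
  rewrite -finset.setUA cardsU1 cards2 !inE !(inj_eq val_inj) b01 negb_or kb0 kb1.
  by move=> /leq_trans/(_ B2).
have [ghat [sghat ghatE]] := bPhi B xC B2.
apply: (factors_quasi_continuous b01 only01) => z.
have [[tX0 pX0] [tX1 pX1]] := (tpX (val b0), tpX (val b1)).
have fX0 := pseudocompact_feebly_compact tX0.2 pX0.
have E u v : restrict_coords Phi xC (dfwith (dfwith z b0 u) b1 v) =
    Phi (dfwith (dfwith (glue_coords z xC) (val b0) u) (val b1) v).
  by rewrite restrict_coords_dfwith glue_coords_dfwith.
have cl u : continuous (fun v => restrict_coords Phi xC (dfwith (dfwith z b0 u) b1 v)).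
  by rewrite (funext (E u)); exact: sPhi.
have cr v : continuous (fun u => restrict_coords Phi xC (dfwith (dfwith z b0 u) b1 v)).
  by rewrite (funext (E^~ v)); exact: continuous_dfwith2l.
apply: truncated_dist_quasi_continuous2 => // c.
have cu : continuous (fun a : R => Num.min 1 `|a - c|).
  by apply: (continuous_truncated_dist (f := id)) => a; exact: cvg_id.
have [a|h ch hE] := stone_cech_unit_extension cu.
  by rewrite le_min ler01 normr_ge0 ge_min lexx.
pose zhat b := stone_cech_in R (z b).
(* Only the second variable is compactified, since feeble compactness of X (val b0) is enough for
   [compact_locally_small]; [h] brings the values from beta R back to R. *)
pose Psi u q := h (ghat (dfwith (dfwith zhat b0 (stone_cech_in R u)) b1 q)).
have PsiE u v : Psi u (stone_cech_in R v) =
    Num.min 1 `|restrict_coords Phi xC (dfwith (dfwith z b0 u) b1 v) - c|.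
  rewrite -hE -ghatE /Psi; congr (h (ghat _)).
  by rewrite 2!(dfwith_map (fun b => @stone_cech_in R (X (val b)))).
have smallPsi : locally_small Psi.
  apply: compact_locally_small => //; first exact: stone_cech_compact.
  - move=> u q; apply: continuous_comp; last exact: ch.
    exact: sghat.
  - move=> q u; apply: continuous_comp; last exact: ch.
    have cq : continuous (fun t => ghat (dfwith (dfwith zhat b1 q) b0 t)) by exact: sghat.
    rewrite (_ : (fun _ => _) = (fun t => ghat (dfwith (dfwith zhat b1 q) b0 t)) \o
        @stone_cech_in R (X (val b0))); last by apply/funext => s /=; rewrite dfwithC.
    by apply: continuous_comp; [exact: stone_cech_in_continuous|exact: cq].
move=> U e oU U0 e0; have [U' [oU' U'0 U'U sU']] := smallPsi U e oU U0 e0.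
by exists U'; split => // u u' v Uu Uu'; rewrite -!PsiE; exact: sU'.
Qed.

Lemma extension_k_beta_extendable :
  (exists Phihat : (forall a, stone_cech R (X a)) -> R,
     separately_continuous Phihat /\
     forall x : (forall a, X a), Phihat (fun a => stone_cech_in R (x a)) = Phi x) ->
  k_beta_extendable R 2 Phi.
Proof.
move=> [Phihat [sPhihat PhihatE]] B xC _.
pose K a := stone_cech R (X a).
pose eC c : K (val c) := stone_cech_in R (xC c).
exists (fun q => stone_cech_in R (Phihat (@glue_coords A K B q eC))); split.
  move=> q b t; apply: continuous_comp; last exact: stone_cech_in_continuous.
  rewrite (_ : (fun _ => _) = fun s => Phihat (dfwith (glue_coords q eC) (val b) s)).
    exact: sPhihat.
  by apply/funext => s; rewrite -glue_coords_dfwith.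
move=> xB; rewrite /restrict_coords -PhihatE; congr (stone_cech_in R (Phihat _)).
apply: glue_coords_ext => [b|c]; first by rewrite glue_coords_in.
by rewrite glue_coords_out.
Qed.

End Restrictions.

Theorem theorem4 (R : realType) (n : nat) (X : 'I_n -> topologicalType)
    (Phi : (forall i : 'I_n, X i) -> R) :
  (0 < n)%N ->
  (forall i : 'I_n, tychonoff_space (X i) /\ pseudocompact_space R (X i)) ->
  separately_continuous Phi ->
  [<-> exists Phihat : (forall i : 'I_n, stone_cech R (X i)) -> R,
         separately_continuous Phihat /\
         forall x : (forall i : 'I_n, X i),
           Phihat (fun i => stone_cech_in R (x i)) = Phi x;
       k_beta_extendable R 2 Phi;
       k_quasicontinuous 2 Phi].
Proof.
move=> _ tpX sPhi; tfae.
- exact: extension_k_beta_extendable.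
- exact: k_beta_extendable_quasicontinuous.
- move=> qPhi; apply: separately_continuous_extension => //.
  + by move=> i; exact: (tpX i).1.
  + by move=> i; exact: (tpX i).2.
  + exact: k_quasicontinuous_double_limit.
Qed.
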